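(* For any cardinal $\kappa\geq 1$, the free IMV-algebra on $\kappa$ generators is (isomorphic to) $\mathcal I(\mathrm{McN}(\Theta^\kappa))$. A free generating set of this algebra is given by the intervals $[\pi_1\circ\boldsymbol\pi_\alpha,\ \pi_2\circ\boldsymbol\pi_\alpha]$ for the ordinals $\alpha<\kappa$, where $\boldsymbol\pi_\alpha\colon\Theta^\kappa\to\Theta$ is the projection onto the $\alpha$-th coordinate and $\pi_1,\pi_2\colon\Theta\to[0,1]$ are $\pi_i(a_1,a_2)=a_i$.
   Context: $\Theta=\{(a,b)\in[0,1]^2\mid a\leq b\}$, so $\Theta^\kappa$ is a nonempty closed subset of the cube $([0,1]^2)^\kappa=[0,1]^{X}$ with $X=\kappa\times\{1,2\}$. For a finite $n>0$, a McNaughton function on $[0,1]^n$ is a continuous piecewise linear map $[0,1]^n\to[0,1]$ each of whose finitely many linear pieces has integer coefficients. For an arbitrary nonempty set $X$, a map $\eta\colon[0,1]^X\to[0,1]$ is a McNaughton map if $\eta=\xi\circ\pi^X_Y$ for some finite $Y\subseteq X$, some McNaughton function $\xi$ on $[0,1]^Y$, and the projection $\pi^X_Y\colon[0,1]^X\to[0,1]^Y$. For a nonempty closed $S\subseteq[0,1]^X$, $\mathrm{McN}(S)$ is the set of restrictions to $S$ of McNaughton maps on $[0,1]^X$, an MV-algebra under the pointwise operations of the standard MV-algebra $[0,1]$ ($\neg a=1-a$, $a\oplus b=\min(1,a+b)$, $a\odot b=\max(0,a+b-1)$), with pointwise order. For an MV-algebra $A$ with natural order $\leq$, $\mathcal I(A)$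 is the set of intervals $[\alpha,\beta]=\{\xi\mid\alpha\leq\xi\leq\beta\}$ ($\alpha\leq\beta$) with constants $0=[0,0]$, $1=[1,1]$, $\iota=A$, operations $\neg x=\{\neg\alpha\mid\alpha\in x\}$, $x\oplus y=\{\alpha\oplus\beta\mid\alpha\in x,\beta\in y\}$, $x\odot y=\{\alpha\odot\beta\mid\alpha\in x,\beta\in y\}$ (these are intervals), $\Delta[\alpha,\beta]=[\alpha,\alpha]$, $\nabla[\alpha,\beta]=[\beta,\beta]$. An IMV-algebra is an algebra $J=(J,0,1,\iota,\neg,\Delta,\nabla,\oplus,\odot)$ of type $(0,0,0,1,1,1,2,2)$ satisfying the equations: $x\oplus(y\oplus z)=(x\oplus y)\oplus z$; $x\oplus y=y\oplus x$; $x\oplus 0=x$; $x\oplus\neg 0=\neg 0$; $\neg\neg x=x$; $\neg(\neg\Delta x\oplus\Delta y)\oplus\Delta y=\neg(\neg\Delta y\oplus\Delta x)\oplus\Delta x$; $x\odot y=\neg(\neg x\oplus\neg y)$; $1=\neg 0$; $\nabla x=\neg\Delta\neg x$; $\neg\iota=\iota$; $\Delta 0=0$; $\Delta 1=1$; $\Delta\iota=0$; $\Delta\Delta x=\Delta x$; $\Delta\nabla x=\nabla x$; $\Delta(x\oplus y)=\Delta x\oplus\Delta y$; $\Delta(x\odot y)=\Delta x\odot\Delta y$; $\Delta x\odot\neg\nabla x=0$; $\Delta x\oplus(\iota\odot\nabla x\odot\neg\Delta x)=x$. *)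

(* Defs.v *)
From HB Require Import structures.
From mathcomp Require Import all_boot all_order all_algebra.
From mathcomp Require Import all_classical all_reals topology normedtype.
From mathcomp Require Import lra.

Set Implicit Arguments.
Unset Strict Implicit.
Unset Printing Implicit Defensive.

Import Order.TTheory GRing.Theory Num.Theory.
Import numFieldNormedType.Exports.

Local Open Scope classical_set_scope.
Local Open Scope ring_scope.

Record mvAlg := MvAlg {
  mv_car :> Type;
  mv0 : mv_car;
  mvN : mv_car -> mv_car;
  mvD : mv_car -> mv_car -> mv_car;
  mvDA : forall x y z, mvD x (mvD y z) = mvD (mvD x y) z;
  mvDC : forall x y, mvD x y = mvD y x;
  mvD0 : forall x, mvD x mv0 = x;
  mvNK : forall x, mvN (mvN x) = x;
  mvDN0 : forall x, mvD x (mvN mv0) = mvN mv0;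
  mv_luk : forall x y,
    mvD (mvN (mvD (mvN x) y)) y = mvD (mvN (mvD (mvN y) x)) x }.

Arguments mv0 {_}.

Definition mv1 {A : mvAlg} : A := mvN mv0.
Definition mvM {A : mvAlg} (x y : A) : A := mvN (mvD (mvN x) (mvN y)).
Definition mvle {A : mvAlg} (x y : A) : Prop := mvD (mvN x) y = mv1.

Section MVTheory.
Variable A : mvAlg.
Implicit Types x y z a b c d t u v : A.

Let mvB x y := mvN (mvD (mvN x) y).

Lemma mv0D x : mvD mv0 x = x. Proof. by rewrite mvDC mvD0. Qed.

Lemma mvNx x : mvD (mvN x) x = mv1.
Proof. by have := mv_luk x mv1; rewrite /mv1 !mvDN0 mvNK mv0D. Qed.

Lemma mvleP x y : mvle x y <-> exists z, y = mvD x z.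
Proof.
split=> [xy|[z ->]]; last by rewrite /mvle mvDA mvNx mvDC /mv1 mvDN0.
exists (mvB y x); rewrite mvDC /mvB -mv_luk.
by rewrite (xy : mvD (mvN x) y = mv1) /mv1 mvNK mv0D.
Qed.

Lemma mvle_refl x : mvle x x. Proof. exact: mvNx. Qed.

Lemma mvle_trans y x z : mvle x y -> mvle y z -> mvle x z.
Proof.
by move=> /mvleP[u ->] /mvleP[v ->]; apply/mvleP;
  exists (mvD u v); rewrite mvDA.
Qed.

Lemma mvle_anti x y : mvle x y -> mvle y x -> x = y.
Proof.
move=> xy yx; have := mv_luk x y; rewrite (xy : _ = mv1) (yx : _ = mv1).
by rewrite /mv1 mvNK !mv0D.
Qed.

Lemma mv0le x : mvle mv0 x.
Proof. by apply/mvleP; exists x; rewrite mv0D. Qed.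

Lemma mvle1 x : mvle x mv1.
Proof. by rewrite /mvle /mv1 mvDN0. Qed.

Lemma mvle_addr x y : mvle x (mvD x y).
Proof. by apply/mvleP; exists y. Qed.

Lemma mvleD a b c d : mvle a b -> mvle c d -> mvle (mvD a c) (mvD b d).
Proof.
move=> /mvleP[u ->] /mvleP[v ->]; apply/mvleP; exists (mvD u v).
by rewrite -!mvDA; congr mvD; rewrite !mvDA; congr mvD; rewrite mvDC.
Qed.

Lemma mvleN x y : mvle x y -> mvle (mvN y) (mvN x).
Proof. by rewrite /mvle mvNK mvDC. Qed.

Lemma mvleM a b c d : mvle a b -> mvle c d -> mvle (mvM a c) (mvM b d).
Proof. by move=> ab cd; apply/mvleN/mvleD; exact: mvleN. Qed.

Let mvB_le x y z : mvle (mvB x y) z <-> mvle x (mvD y z).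
Proof. by rewrite /mvle /mvB mvNK mvDA. Qed.

Let addBK x y : mvle x y -> mvD x (mvB y x) = y.
Proof.
by move=> xy; rewrite mvDC /mvB -mv_luk (xy : _ = mv1) /mv1 mvNK mv0D.
Qed.

Let join x y := mvD (mvB x y) y.
Let joinC x y : join x y = join y x. Proof. exact: mv_luk. Qed.
Let le_joinr x y : mvle y (join x y).
Proof. by rewrite /join mvDC; exact: mvle_addr. Qed.
Let le_joinl x y : mvle x (join x y).
Proof. by rewrite joinC; exact: le_joinr. Qed.
Let join_le x y z : mvle x z -> mvle y z -> mvle (join x y) z.
Proof.
move=> xz yz; rewrite -(addBK yz) /join mvDC; apply: mvleD.
  exact: mvle_refl.
by apply/mvB_le; rewrite addBK.
Qed.

Let meet x y := mvN (join (mvN x) (mvN y)).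
Let meet_lel x y : mvle (meet x y) x.
Proof. by rewrite -{2}(mvNK x); apply/mvleN/le_joinl. Qed.
Let meet_ler x y : mvle (meet x y) y.
Proof. by rewrite -{2}(mvNK y); apply/mvleN/le_joinr. Qed.
Let le_meet x y z : mvle z x -> mvle z y -> mvle z (meet x y).
Proof.
by move=> zx zy; rewrite -(mvNK z); apply/mvleN/join_le; exact: mvleN.
Qed.

Let riesz t u v : mvle t (mvD u v) ->
  exists u' v', [/\ mvle u' u, mvle v' v & t = mvD u' v'].
Proof.
move=> tuv; exists (meet t u), (mvB t (meet t u)); split; first exact: meet_ler.
- apply/mvB_le; rewrite mvDC; apply/mvB_le/le_meet; apply/mvB_le.
    by rewrite mvDC; exact: mvle_addr.
  by rewrite mvDC.
- by rewrite addBK //; exact: meet_lel.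
Qed.

Lemma mv_interval_splitD a b c d t : mvle a b -> mvle c d ->
  mvle (mvD a c) t -> mvle t (mvD b d) ->
  exists x y, [/\ mvle a x /\ mvle x b, mvle c y /\ mvle y d & mvD x y = t].
Proof.
move=> ab cd act tbd.
have /riesz[u [v [ub vd tE]]] :
    mvle (mvB t (mvD a c)) (mvD (mvB b a) (mvB d c)).
  apply/mvB_le; move: tbd; rewrite -{1}(addBK ab) -{1}(addBK cd).
  have -> // : forall p q r s : A,
    mvD (mvD p q) (mvD r s) = mvD (mvD p r) (mvD q s).
  by move=> p q r s; rewrite -!mvDA; congr mvD; rewrite !mvDA; congr mvD;
    rewrite mvDC.
exists (mvD a u), (mvD c v); split; [split|split|].
- exact: mvle_addr.
- by rewrite -(addBK ab); apply: mvleD => //; exact: mvle_refl.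
- exact: mvle_addr.
- by rewrite -(addBK cd); apply: mvleD => //; exact: mvle_refl.
- rewrite -[RHS](addBK act) tE -!mvDA; congr mvD; rewrite !mvDA; congr mvD.
  by rewrite mvDC.
Qed.

End MVTheory.

Section IntervalAlgebra.
Variable A : mvAlg.
Implicit Types (a b c d : A) (X Y : set A).

Definition itv_set a b : set A := [set t | mvle a t /\ mvle t b].

Definition is_mv_interval X := exists a b, mvle a b /\ X = itv_set a b.

Definition mv_interval := {X : set A | is_mv_interval X}.

Fact itv_is_interval a b : mvle a b -> is_mv_interval (itv_set a b).
Proof. by exists a, b. Qed.

Definition mk_itv a b (ab : mvle a b) : mv_interval :=
  exist is_mv_interval _ (itv_is_interval ab).

Lemma mv_interval_inj (x y : mv_interval) : sval x = sval y -> x = y.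
Proof.
case: x y => [X pX] [Y pY] /= XY; subst Y; congr exist; exact: Prop_irrelevance.
Qed.

Lemma mvN_itv a b : [set mvN t | t in itv_set a b] = itv_set (mvN b) (mvN a).
Proof.
apply/seteqP; split=> [_ [t [at_ tb] <-]|t [bt ta]].
  by split; exact: mvleN.
exists (mvN t); last exact: mvNK.
by split; [rewrite -(mvNK a)|rewrite -(mvNK b)]; exact: mvleN.
Qed.

Lemma mvD_itv a b c d : mvle a b -> mvle c d ->
  [set mvD s t | s in itv_set a b & t in itv_set c d] =
  itv_set (mvD a c) (mvD b d).
Proof.
move=> ab cd; apply/seteqP; split=> [_ [s [as_ sb] [t [ct td] <-]]|t [lt tu]].
  by split; exact: mvleD.
by have [x [y [xab ycd <-]]] := mv_interval_splitD ab cd lt tu;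
  exists x => //; exists y.
Qed.

Lemma mvM_itv a b c d : mvle a b -> mvle c d ->
  [set mvM s t | s in itv_set a b & t in itv_set c d] =
  itv_set (mvM a c) (mvM b d).
Proof.
move=> ab cd; rewrite /mvM -mvN_itv -mvD_itv; [|exact: mvleN..].
rewrite -!mvN_itv; apply/seteqP; split=> [_ [s sab [t tcd <-]]|].
  exists (mvD (mvN s) (mvN t)) => //.
  by exists (mvN s); [exists s|exists (mvN t) => //; exists t].
by move=> _ [_ [_ [s sab <-] [_ [t tcd <-] <-]] <-]; exists s => //; exists t.
Qed.

Fact is_mv_interval_neg X : is_mv_interval X ->
  is_mv_interval [set mvN t | t in X].
Proof.
by move=> [a [b [ab ->]]]; rewrite mvN_itv; apply/itv_is_interval/mvleN.
Qed.

Fact is_mv_interval_oplus X Y : is_mv_interval X -> is_mv_interval Y ->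
  is_mv_interval [set mvD s t | s in X & t in Y].
Proof.
move=> [a [b [ab ->]]] [c [d [cd ->]]]; rewrite mvD_itv //.
exact/itv_is_interval/mvleD.
Qed.

Fact is_mv_interval_odot X Y : is_mv_interval X -> is_mv_interval Y ->
  is_mv_interval [set mvM s t | s in X & t in Y].
Proof.
move=> [a [b [ab ->]]] [c [d [cd ->]]]; rewrite mvM_itv //.
exact/itv_is_interval/mvleM.
Qed.

Definition itv_neg (x : mv_interval) : mv_interval :=
  exist is_mv_interval _ (is_mv_interval_neg (svalP x)).
Definition itv_oplus (x y : mv_interval) : mv_interval :=
  exist is_mv_interval _ (is_mv_interval_oplus (svalP x) (svalP y)).
Definition itv_odot (x y : mv_interval) : mv_interval :=
  exist is_mv_interval _ (is_mv_interval_odot (svalP x) (svalP y)).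

(* The endpoints are picked by choice; [itv_loE] and [itv_hiE] show that they
   are determined by the interval. *)
Definition itv_lo (x : mv_interval) : A := projT1 (cid (svalP x)).
Definition itv_hi (x : mv_interval) : A :=
  projT1 (cid (projT2 (cid (svalP x)))).

Lemma itv_lohi (x : mv_interval) :
  mvle (itv_lo x) (itv_hi x) /\ sval x = itv_set (itv_lo x) (itv_hi x).
Proof. by rewrite /itv_lo /itv_hi; case: cid => a /= Ha; case: cid. Qed.

Lemma itv_set_inj a b c d : mvle a b -> mvle c d ->
  itv_set a b = itv_set c d -> a = c /\ b = d.
Proof.
move=> ab cd E.
have [ca _] : itv_set c d a by rewrite -E; split=> //; exact: mvle_refl.
have [ac _] : itv_set a b c by rewrite E; split=> //; exact: mvle_refl.
have [_ bd] : itv_set c d b by rewrite -E; split=> //; exact: mvle_refl.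
have [_ db] : itv_set a b d by rewrite E; split=> //; exact: mvle_refl.
by split; exact: mvle_anti.
Qed.

Lemma itv_loE a b (ab : mvle a b) : itv_lo (mk_itv ab) = a.
Proof.
have [lh E] := itv_lohi (mk_itv ab).
by have [] := itv_set_inj ab lh E.
Qed.

Lemma itv_hiE a b (ab : mvle a b) : itv_hi (mk_itv ab) = b.
Proof.
have [lh E] := itv_lohi (mk_itv ab).
by have [] := itv_set_inj ab lh E.
Qed.

Definition itv_point a : mv_interval := mk_itv (mvle_refl a).

Definition itv_Delta (x : mv_interval) : mv_interval := itv_point (itv_lo x).
Definition itv_Nabla (x : mv_interval) : mv_interval := itv_point (itv_hi x).

Fact is_mv_interval_setT : is_mv_interval [set: A].
Proof.
exists mv0, mv1; split; first exact: mv0le.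
by apply/seteqP; split=> // t _; split; [exact: mv0le|exact: mvle1].
Qed.

Definition itv_iota : mv_interval := exist is_mv_interval _ is_mv_interval_setT.

End IntervalAlgebra.

Record imvSig := ImvSig {
  imv_car :> Type;
  imv0 : imv_car;
  imv1 : imv_car;
  imv_iota : imv_car;
  imvN : imv_car -> imv_car;
  Delta : imv_car -> imv_car;
  Nabla : imv_car -> imv_car;
  imvD : imv_car -> imv_car -> imv_car;
  imvM : imv_car -> imv_car -> imv_car }.

Arguments imv0 {_}.
Arguments imv1 {_}.
Arguments imv_iota {_}.

Declare Scope imv_scope.
Delimit Scope imv_scope with IMV.
Notation "0" := (@imv0 _) : imv_scope.
Notation "1" := (@imv1 _) : imv_scope.
Notation "'ι'" := (@imv_iota _) (at level 0) : imv_scope.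
Notation "¬ x" := (imvN x) (at level 35, right associativity) : imv_scope.
Notation "'Δ' x" := (Delta x) (at level 35, right associativity) : imv_scope.
Notation "'∇' x" := (Nabla x) (at level 35, right associativity) : imv_scope.
Notation "x ⊕ y" := (imvD x y) (at level 50, left associativity) : imv_scope.
Notation "x ⊙ y" := (imvM x y) (at level 40, left associativity) : imv_scope.

Record is_IMV (J : imvSig) : Prop := {
  imvDA : forall x y z : J, (x ⊕ (y ⊕ z) = (x ⊕ y) ⊕ z)%IMV;
  imvDC : forall x y : J, (x ⊕ y = y ⊕ x)%IMV;
  imvD0 : forall x : J, (x ⊕ 0 = x)%IMV;
  imvDN0 : forall x : J, (x ⊕ ¬ 0 = ¬ 0)%IMV;
  imvNK : forall x : J, (¬ ¬ x = x)%IMV;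
  imv_luk : forall x y : J,
    (¬ (¬ Δ x ⊕ Δ y) ⊕ Δ y = ¬ (¬ Δ y ⊕ Δ x) ⊕ Δ x)%IMV;
  imvME : forall x y : J, (x ⊙ y = ¬ (¬ x ⊕ ¬ y))%IMV;
  imv1E : (1 = ¬ 0 :> J)%IMV;
  NablaE : forall x : J, (∇ x = ¬ Δ ¬ x)%IMV;
  imvN_iota : (¬ ι = ι :> J)%IMV;
  Delta0 : (Δ 0 = 0 :> J)%IMV;
  Delta1 : (Δ 1 = 1 :> J)%IMV;
  Delta_iota : (Δ ι = 0 :> J)%IMV;
  DeltaK : forall x : J, (Δ Δ x = Δ x)%IMV;
  Delta_Nabla : forall x : J, (Δ ∇ x = ∇ x)%IMV;
  DeltaD : forall x y : J, (Δ (x ⊕ y) = Δ x ⊕ Δ y)%IMV;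
  DeltaM : forall x y : J, (Δ (x ⊙ y) = Δ x ⊙ Δ y)%IMV;
  Delta_le_Nabla : forall x : J, (Δ x ⊙ ¬ ∇ x = 0)%IMV;
  imv_decomp : forall x : J, (Δ x ⊕ (ι ⊙ ∇ x ⊙ ¬ Δ x) = x)%IMV }.

Record imv_hom (J J' : imvSig) (h : J -> J') : Prop := {
  hom0 : h 0%IMV = 0%IMV;
  hom1 : h 1%IMV = 1%IMV;
  hom_iota : h ι%IMV = ι%IMV;
  homN : forall x, h (¬ x)%IMV = (¬ h x)%IMV;
  homDelta : forall x, h (Δ x)%IMV = (Δ h x)%IMV;
  homNabla : forall x, h (∇ x)%IMV = (∇ h x)%IMV;
  homD : forall x y, h (x ⊕ y)%IMV = (h x ⊕ h y)%IMV;
  homM : forall x y, h (x ⊙ y)%IMV = (h x ⊙ h y)%IMV }.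

Definition imv_iso (J J' : imvSig) (h : J -> J') : Prop :=
  imv_hom h /\ bijective h.

Record imv_subuniverse (J : imvSig) (P : set J) : Prop := {
  sub0 : P 0%IMV;
  sub1 : P 1%IMV;
  sub_iota : P ι%IMV;
  subN : forall x, P x -> P (¬ x)%IMV;
  subDelta : forall x, P x -> P (Δ x)%IMV;
  subNabla : forall x, P x -> P (∇ x)%IMV;
  subD : forall x y, P x -> P y -> P (x ⊕ y)%IMV;
  subM : forall x y, P x -> P y -> P (x ⊙ y)%IMV }.

Definition imv_generates (J : imvSig) (G : set J) : Prop :=
  forall P : set J, imv_subuniverse P -> G `<=` P -> P = setT.

(* J is a free IMV-algebra and g enumerates, without repetition, a free
   generating set of J. *)
Record is_free_IMV (K : Type) (J : imvSig) (g : K -> J) : Prop := {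
  free_IMV : is_IMV J;
  free_inj : injective g;
  free_gen : imv_generates (range g);
  free_ump : forall J' : imvSig, is_IMV J' -> forall f : K -> J',
    exists! h : J -> J', imv_hom h /\ (forall k, h (g k) = f k) }.

Definition intervalAlg (A : mvAlg) : imvSig := {|
  imv_car := mv_interval A;
  imv0 := itv_point mv0;
  imv1 := itv_point mv1;
  imv_iota := itv_iota A;
  imvN := @itv_neg A;
  Delta := @itv_Delta A;
  Nabla := @itv_Nabla A;
  imvD := @itv_oplus A;
  imvM := @itv_odot A |}.

Section UnitInterval.
Variable R : realType.

Definition unitI := {x : R | 0 <= x <= 1}.

Implicit Types a b c : unitI.

Lemma unitI_inj a b : sval a = sval b -> a = b.
Proof. by move=> ab; apply: val_inj. Qed.

Fact u0_subproof : 0 <= (0 : R) <= 1. Proof. by rewrite lexx ler01. Qed.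
Fact uN_subproof a : 0 <= 1 - sval a <= 1.
Proof. by case: a => x /= /andP[x0 x1]; rewrite subr_ge0 x1 gerBl. Qed.
Fact uD_subproof a b : 0 <= Num.min 1 (sval a + sval b) <= 1.
Proof.
case: a b => [x /= /andP[x0 _]] [y /= /andP[y0 _]].
by rewrite le_min ler01 addr_ge0 //= ge_min lexx.
Qed.

Definition u0 : unitI := exist _ 0 u0_subproof.
Definition uN a : unitI := exist _ (1 - sval a) (uN_subproof a).
Definition uD a b : unitI :=
  exist _ (Num.min 1 (sval a + sval b)) (uD_subproof a b).

Ltac unitI_lra :=
  repeat match goal with |- context [Order.min ?a ?b] =>
    lazymatch b with
    | context [Order.min _ _] => fail
    | _ => case: (leP a b) => ?
    end
  end; lra.

Fact uDA a b c : uD a (uD b c) = uD (uD a b) c.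
Proof.
apply: unitI_inj; move: a b c => [x /= /andP[? ?]] [y /= /andP[? ?]].
by move=> [z /= /andP[? ?]]; unitI_lra.
Qed.

Fact uDC a b : uD a b = uD b a.
Proof. by apply: unitI_inj; rewrite /= addrC. Qed.

Fact uD0 a : uD a u0 = a.
Proof. by apply: unitI_inj; move: a => [x /= /andP[? ?]]; unitI_lra. Qed.

Fact uNK a : uN (uN a) = a.
Proof. by apply: unitI_inj; rewrite /= opprB addrC subrK. Qed.

Fact uDN0 a : uD a (uN u0) = uN u0.
Proof. by apply: unitI_inj; move: a => [x /= /andP[? ?]]; unitI_lra. Qed.

Fact u_luk a b : uD (uN (uD (uN a) b)) b = uD (uN (uD (uN b) a)) a.
Proof.
apply: unitI_inj; move: a b => [x /= /andP[? ?]] [y /= /andP[? ?]].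
by unitI_lra.
Qed.

Definition unitI_mv : mvAlg := MvAlg uDA uDC uD0 uNK uDN0 u_luk.

Lemma unitI_mvME (a b : unitI_mv) :
  sval (mvM a b) = Num.max 0 (sval a + sval b - 1).
Proof.
move: a b => [x /= /andP[? ?]] [y /= /andP[? ?]].
by rewrite /= maxEle; case: leP => ?; unitI_lra.
Qed.

Lemma unitI_mvleE (a b : unitI_mv) : mvle a b <-> sval a <= sval b.
Proof.
move: a b => [x xx] [y yy]; have /= /andP[? ?] := xx; have /= /andP[? ?] := yy.
split=> [/(congr1 sval) /=|xy].
  by unitI_lra.
by apply: unitI_inj => /=; unitI_lra.
Qed.

End UnitInterval.

Section McNaughton.
Variable R : realType.

Definition cube n : set 'rV[R]_n := [set x | forall i, 0 <= x 0 i <= 1].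

(* Only the values of xi on the cube matter. *)
Definition mcnaughton_function n (xi : 'rV[R]_n -> R) : Prop :=
  [/\ forall x, cube x -> 0 <= xi x <= 1,
      {within cube (n := n), continuous xi} &
      exists pieces : seq ('rV[int]_n * int), forall x, cube x ->
        exists2 p, p \in pieces &
          xi x = \sum_i (p.1 0 i)%:~R * x 0 i + p.2%:~R].

(* The finite subset Y of X is the image of the injection i : 'I_n -> X, which
   also identifies [0,1]^Y with the cube [0,1]^n. *)
Definition mcnaughton_map (X : Type) (eta : (X -> unitI R) -> unitI R) : Prop :=
  exists n (i : 'I_n -> X) (xi : 'rV[R]_n -> R),
    [/\ (0 < n)%N, injective i, mcnaughton_function xi &
        forall x, sval (eta x) = xi (\row_j sval (x (i j)))].

Definition McN_set (X : Type) (S : set (X -> unitI R)) : set (S -> unitI R) :=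
  [set f | exists2 eta, mcnaughton_map eta & forall x, f x = eta (sval x)].

Lemma mcnaughton_function_reindex n m (s : 'I_n -> 'I_m) (xi : 'rV[R]_n -> R) :
  mcnaughton_function xi ->
  mcnaughton_function (fun y : 'rV[R]_m => xi (\row_j y 0 (s j))).
Proof.
move=> [xi01 xic [L HL]].
have cubeP (y : 'rV[R]_m) : cube y -> cube (\row_j y 0 (s j)).
  by move=> cy j; rewrite mxE.
split.
- by move=> y /cubeP; exact: xi01.
- apply/subspace_continuousP => y cy.
  have /subspace_continuousP/(_ _ (cubeP _ cy)) := xic.
  apply: cvg_trans => B /= /(@nbhs_ballP R)[e /= e0 HB].
  apply/(@nbhs_ballP R); exists e => //= z yz cz.
  apply: HB => /=; last exact: cubeP.
  by case: yz => _ yz; split=> // i j; rewrite !mxE; exact: yz.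
- pose F (p : 'rV[int]_n * int) : 'rV[int]_m * int :=
    (\row_k (\sum_(j | s j == k) p.1 0 j), p.2).
  exists (map F L) => y cy; have [p pL ->] := HL _ (cubeP _ cy).
  exists (F p) => /=; first exact: map_f.
  congr (_ + _); rewrite (partition_big s xpredT) //=; apply: eq_bigr => k _.
  rewrite mxE rmorph_sum /= mulr_suml; apply: eq_bigr => j /eqP <-.
  by rewrite mxE.
Qed.

Lemma mcnaughton_function_cst0 n :
  mcnaughton_function (fun _ : 'rV[R]_n => 0).
Proof.
split; [by move=> *; rewrite lexx ler01|by move=> x; exact: cvg_cst|].
exists [:: (0, 0)] => x _; exists (0, 0); rewrite ?inE //=.
by rewrite big1 ?addr0// => i _; rewrite mxE mul0r.
Qed.

Lemma mcnaughton_function_coord n (k : 'I_n) :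
  mcnaughton_function (fun x : 'rV[R]_n => x 0 k).
Proof.
split; first by [].
  by apply: continuous_subspaceT => x; exact: coord_continuous.
exists [:: (delta_mx 0 k, 0)] => x _.
exists (delta_mx 0 k, 0); rewrite ?inE //=.
rewrite addr0 (bigD1 k) //= mxE !eqxx mul1r big1 ?addr0 // => i ik.
by rewrite mxE (negbTE ik) andbF mul0r.
Qed.

Lemma mcnaughton_functionN n (xi : 'rV[R]_n -> R) :
  mcnaughton_function xi -> mcnaughton_function (fun x => 1 - xi x).
Proof.
move=> [xi01 xic [L HL]]; split.
- by move=> x /xi01/andP[? ?]; apply/andP; split; lra.
- by move=> x; apply: cvgB; [exact: cvg_cst|exact: xic].
- exists [seq (- p.1, 1 - p.2) | p : 'rV[int]_n * int <- L] => x /HL[p pL ->].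
  exists (- p.1, 1 - p.2) => /=; first by apply/mapP; exists p.
  rewrite rmorphB /= opprD addrCA -sumrN; congr (_ + _).
  by apply: eq_bigr => i _; rewrite mxE rmorphN mulNr.
Qed.

Lemma mcnaughton_functionD n (xi zeta : 'rV[R]_n -> R) :
  mcnaughton_function xi -> mcnaughton_function zeta ->
  mcnaughton_function (fun x => Num.min 1 (xi x + zeta x)).
Proof.
move=> [xi01 xic [L HL]] [ze01 zec [M HM]]; split.
- move=> x cx; have /andP[? ?] := xi01 _ cx; have /andP[? ?] := ze01 _ cx.
  by rewrite le_min ler01 ge_min lexx addr_ge0.
- move=> x; apply: (@continuous_min R (subspace (cube (n := n)))
    (fun=> 1) (fun x => xi x + zeta x)); first exact: cvg_cst.
  by apply: cvgD; [exact: xic|exact: zec].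
- exists ((0, 1) :: [seq (p.1 + q.1, p.2 + q.2) | p <- L, q <- M]) => x cx.
  have [p pL ->] := HL _ cx; have [q qM ->] := HM _ cx.
  have [h|h] := leP 1 _.
    exists (0, 1); rewrite ?inE ?eqxx //=.
    by rewrite big1 ?add0r// => i _; rewrite mxE mul0r.
  exists (p.1 + q.1, p.2 + q.2).
    by rewrite inE; apply/orP; right; apply/allpairsP; exists (p, q).
  rewrite /= rmorphD /= addrACA -big_split /=; congr (_ + _).
  by apply: eq_bigr => i _; rewrite mxE rmorphD mulrDl.
Qed.

Lemma finite_family_factor (X : Type) n (f : 'I_n -> X) :
  exists m (i : 'I_m -> X) (s : 'I_n -> 'I_m),
    injective i /\ forall j, i (s j) = f j.
Proof.
pose F : 'I_n -> {classic X} := f.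
pose r := undup (codom F).
have idx j : (index (F j) r < size r)%N.
  by rewrite index_mem mem_undup codom_f.
exists (size r), (fun k : 'I_(size r) => tnth (in_tuple r) k).
exists (fun j => Ordinal (idx j)); split.
  have /tuple_uniqP inj : uniq (in_tuple r) by exact: undup_uniq.
  exact: inj.
by move=> j; rewrite (tnth_nth (F j)) /= nth_index // mem_undup codom_f.
Qed.

Variable X : Type.
Implicit Types eta zeta : (X -> unitI R) -> unitI R.

Lemma mcnaughton_map0 : inhabited X ->
  mcnaughton_map (fun _ : X -> unitI R => u0 R).
Proof.
move=> [x0]; exists 1%N, (fun=> x0), (fun=> 0); split=> //.
  by move=> i j _; rewrite !ord1.
exact: mcnaughton_function_cst0.
Qed.

Lemma mcnaughton_map_proj (k : X) :
  mcnaughton_map (fun x : X -> unitI R => x k).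
Proof.
exists 1%N, (fun=> k), (fun y => y 0 0); split=> //.
- by move=> i j _; rewrite !ord1.
- exact: mcnaughton_function_coord.
- by move=> x; rewrite mxE.
Qed.

Lemma mcnaughton_mapN eta : mcnaughton_map eta ->
  mcnaughton_map (fun x => uN (eta x)).
Proof.
move=> [n [i [xi [n0 ii mxi E]]]]; exists n, i, (fun y => 1 - xi y).
by split=> // [|x]; [exact: mcnaughton_functionN|rewrite /= E].
Qed.

Lemma mcnaughton_mapD eta zeta : mcnaughton_map eta -> mcnaughton_map zeta ->
  mcnaughton_map (fun x => uD (eta x) (zeta x)).
Proof.
move=> [n1 [i1 [xi1 [n10 ii1 mxi1 E1]]]] [n2 [i2 [xi2 [n20 ii2 mxi2 E2]]]].
have [m [i [s [ii sE]]]] := finite_family_factor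
  (fun j : 'I_(n1 + n2) =>
    match fintype.split j with inl a => i1 a | inr b => i2 b end).
pose s1 a := s (lshift n2 a); pose s2 b := s (rshift n1 b).
have s1E a : i (s1 a) = i1 a.
  by rewrite sE -[lshift _ _]/(unsplit (inl a)) unsplitK.
have s2E b : i (s2 b) = i2 b.
  by rewrite sE -[rshift _ _]/(unsplit (inr b)) unsplitK.
exists m, i, (fun y =>
  Num.min 1 (xi1 (\row_j y 0 (s1 j)) + xi2 (\row_j y 0 (s2 j)))).
split=> //.
- by rewrite (leq_ltn_trans _ (ltn_ord (s1 (Ordinal n10)))).
- by apply: mcnaughton_functionD; exact: mcnaughton_function_reindex.
- move=> x; rewrite /= E1 E2; congr (Num.min 1 (xi1 _ + xi2 _)).
    by apply/rowP => j; rewrite !mxE s1E.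
  by apply/rowP => j; rewrite !mxE s2E.
Qed.

(* X is nonempty: otherwise there is no McNaughton map at all. *)
Variables (X0 : inhabited X) (S : set (X -> unitI R)).

Definition McN_car := {f : S -> unitI R | McN_set f}.

Implicit Types f g h : McN_car.

Lemma McN_inj f g : (forall x, sval f x = sval g x) -> f = g.
Proof.
case: f g => [f pf] [g pg] /= /funext fg; subst g; congr exist.
exact: Prop_irrelevance.
Qed.

Fact McN0_subproof : @McN_set X S (fun=> u0 R).
Proof. by exists (fun=> u0 R) => //; exact: mcnaughton_map0. Qed.

Fact McNN_subproof f : McN_set (fun x => uN (sval f x)).
Proof.
case: f => f [eta meta E] /=; exists (fun x => uN (eta x)).
  exact: mcnaughton_mapN.
by move=> x; rewrite E.
Qed.

Fact McND_subproof f g : McN_set (fun x => uD (sval f x) (sval g x)).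
Proof.
case: f g => [f [eta meta E]] [g [zeta mzeta E']] /=.
exists (fun x => uD (eta x) (zeta x)); first exact: mcnaughton_mapD.
by move=> x; rewrite E E'.
Qed.

Definition McN0 : McN_car := exist _ _ McN0_subproof.
Definition McNN f : McN_car := exist _ _ (McNN_subproof f).
Definition McND f g : McN_car := exist _ _ (McND_subproof f g).

Fact McNDA f g h : McND f (McND g h) = McND (McND f g) h.
Proof. by apply: McN_inj => x /=; rewrite uDA. Qed.
Fact McNDC f g : McND f g = McND g f.
Proof. by apply: McN_inj => x /=; rewrite uDC. Qed.
Fact McND0 f : McND f McN0 = f.
Proof. by apply: McN_inj => x /=; rewrite uD0. Qed.
Fact McNNK f : McNN (McNN f) = f.
Proof. by apply: McN_inj => x /=; rewrite uNK. Qed.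
Fact McNDN0 f : McND f (McNN McN0) = McNN McN0.
Proof. by apply: McN_inj => x /=; rewrite uDN0. Qed.
Fact McN_luk f g :
  McND (McNN (McND (McNN f) g)) g = McND (McNN (McND (McNN g) f)) f.
Proof. by apply: McN_inj => x /=; rewrite u_luk. Qed.

Definition McN : mvAlg := MvAlg McNDA McNDC McND0 McNNK McNDN0 McN_luk.

Lemma McN_leE (f g : McN) :
  mvle f g <-> forall x, sval (sval f x) <= sval (sval g x).
Proof.
split=> [fg x|fg].
  by apply/unitI_mvleE; have := congr1 (fun h : McN => sval h x) fg.
by apply: McN_inj => x; have /unitI_mvleE := fg x.
Qed.

End McNaughton.

Arguments McN R {X} X0 S.

Section Theta.
Variables (R : realType) (K : Type).

Definition Theta : set (unitI R * unitI R) := [set p | sval p.1 <= sval p.2].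

(* [0,1]^(K * bool) is identified with ([0,1]^2)^K: the second component of the
   index is false for the first coordinate of the pair, true for the second. *)
Definition pair_at (k : K) (x : K * bool -> unitI R) : unitI R * unitI R :=
  (x (k, false), x (k, true)).

Definition Theta_pow : set (K * bool -> unitI R) :=
  [set x | forall k, Theta (pair_at k x)].

Hypothesis K0 : inhabited K.

Fact inhabited_index : inhabited (K * bool).
Proof. by case: K0 => k; exact: (inhabits (k, false)). Qed.

Definition McN_Theta : mvAlg := McN R inhabited_index Theta_pow.

Fact gen_lo_subproof (k : K) :
  McN_set (fun x : Theta_pow => (pair_at k (sval x)).1).
Proof.
by exists (fun x => x (k, false)) => //; exact: mcnaughton_map_proj.
Qed.

Fact gen_hi_subproof (k : K) :
  McN_set (fun x : Theta_pow => (pair_at k (sval x)).2).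
Proof.
by exists (fun x => x (k, true)) => //; exact: mcnaughton_map_proj.
Qed.

Definition gen_lo (k : K) : McN_Theta := exist _ _ (gen_lo_subproof k).
Definition gen_hi (k : K) : McN_Theta := exist _ _ (gen_hi_subproof k).

Fact gen_le (k : K) : mvle (gen_lo k) (gen_hi k).
Proof. by apply/McN_leE => x; exact: (set_valP x k). Qed.

Definition generator (k : K) : intervalAlg McN_Theta := mk_itv (gen_le k).

End Theta.

Arguments Theta_pow : clear implicits.
Arguments McN_Theta R {K} K0.
Arguments generator R {K} K0 k.

(* Main.v *)
(** The Delta-fixed elements of an IMV-algebra [J] form an MV-algebra, and an
    element of [J] is the same thing as a pair [Delta x <= Nabla x] of such
    elements.  So an IMV-homomorphism out of the interval algebra of [A] is an
    MV-homomorphism out of [A], and it suffices to show that [McN(Theta^K)] is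
    the free MV-algebra over pairs of generators [a_k <= b_k].

    It is generated by the coordinates (McNaughton's theorem): a McNaughton
    function is a max-min of its affine pieces, and clamped affine functions are
    terms by the recursion of Rose and Rosser.  Terms that agree on [Theta^K]
    agree in every MV-algebra at points with [a_k <= b_k]: replacing [a_k] by
    its meet with [b_k] reduces this to Chang's completeness theorem.  For the
    latter, a nonzero element survives in the quotient by a prime ideal, an
    MV-chain, which is the unit interval of a totally ordered abelian group; a
    finite system of integer linear inequalities that is solvable in such a
    group is solvable in the reals, by Fourier-Motzkin elimination. *)

Require Import Defs.
From HB Require Import structures.
From mathcomp Require Import all_boot all_order all_algebra.
From mathcomp Require Import all_classical all_reals topology normedtype.
From mathcomp Require Import ring lra zify.

Set Implicit Arguments.
Unset Strict Implicit.
Unset Printing Implicit Defensive.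

Import Order.TTheory GRing.Theory Num.Theory.
Import numFieldNormedType.Exports.

Local Open Scope classical_set_scope.
Local Open Scope ring_scope.

(** * MV-algebras and prime ideals *)

Section MVLattice.
Variable A : mvAlg.
Implicit Types a b c d j p q x y z : A.

Definition mvB x y : A := mvN (mvD (mvN x) y).
Definition mvmax x y : A := mvD (mvB x y) y.
Definition mvmin x y : A := mvN (mvmax (mvN x) (mvN y)).

Lemma mvN1 : mvN (@mv1 A) = mv0. Proof. exact: mvNK. Qed.

Lemma mvD1 x : mvD x mv1 = mv1. Proof. exact: mvDN0. Qed.

Lemma mv1D x : mvD mv1 x = mv1. Proof. by rewrite mvDC mvD1. Qed.

Lemma mvDAC x y z : mvD (mvD x y) z = mvD (mvD x z) y.
Proof. by rewrite -!mvDA (mvDC y). Qed.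

Lemma mvN_inj : injective (@mvN A).
Proof. by move=> x y xy; rewrite -(mvNK x) xy mvNK. Qed.

Lemma mvMC x y : mvM x y = mvM y x. Proof. by rewrite /mvM mvDC. Qed.

Lemma mvMA x y z : mvM x (mvM y z) = mvM (mvM x y) z.
Proof. by rewrite /mvM !mvNK mvDA. Qed.

Lemma mvle0 x : mvle x mv0 -> x = mv0.
Proof. by move=> /mvle_anti; apply; exact: mv0le. Qed.

Lemma mv1le x : mvle mv1 x -> x = mv1.
Proof. by move=> /(mvle_anti (mvle1 x)). Qed.

Lemma mvle_addl x y : mvle x (mvD y x).
Proof. by rewrite mvDC; exact: mvle_addr. Qed.

Lemma mvB_leP x y z : mvle (mvB x y) z <-> mvle x (mvD y z).
Proof. by rewrite /mvle /mvB mvNK mvDA. Qed.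

Lemma mvBK x y : mvle x y -> mvD x (mvB y x) = y.
Proof.
by move=> xy; rewrite mvDC /mvB -mv_luk (xy : _ = mv1) /mv1 mvNK mv0D.
Qed.

Lemma mvB_eq0 x y : mvB x y = mv0 <-> mvle x y.
Proof.
split=> [xy|xy]; last by rewrite /mvB (xy : _ = mv1) mvN1.
by apply: mvN_inj; rewrite mvN1 -xy.
Qed.

Lemma mvDK a b : mvle b (mvN a) -> mvB (mvD a b) a = b.
Proof.
move=> /mvleN; rewrite mvNK => /mvBK ab; apply: mvN_inj.
by rewrite -[RHS]ab /mvB !mvNK mvDC (mvDC b).
Qed.

Lemma mvMNx x : mvM (mvN x) x = mv0.
Proof. by rewrite /mvM mvNK mvDC mvNx mvN1. Qed.

Lemma mvmaxC x y : mvmax x y = mvmax y x. Proof. exact: mv_luk. Qed.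

Lemma mvle_maxr x y : mvle y (mvmax x y). Proof. exact: mvle_addl. Qed.

Lemma mvle_maxl x y : mvle x (mvmax x y).
Proof. by rewrite mvmaxC; exact: mvle_maxr. Qed.

Lemma mvmax_le x y z : mvle x z -> mvle y z -> mvle (mvmax x y) z.
Proof.
move=> xz yz; rewrite -(mvBK yz) /mvmax mvDC; apply: mvleD.
  exact: mvle_refl.
by apply/mvB_leP; rewrite mvBK.
Qed.

Lemma mvmin_lel x y : mvle (mvmin x y) x.
Proof. by rewrite -{2}(mvNK x); apply/mvleN/mvle_maxl. Qed.

Lemma mvmin_ler x y : mvle (mvmin x y) y.
Proof. by rewrite -{2}(mvNK y); apply/mvleN/mvle_maxr. Qed.

Lemma mvle_min x y z : mvle z x -> mvle z y -> mvle z (mvmin x y).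
Proof.
by move=> zx zy; rewrite -(mvNK z); apply/mvleN/mvmax_le; exact: mvleN.
Qed.

Lemma mvmin_l x y : mvle x y -> mvmin x y = x.
Proof.
move=> xy; apply: mvle_anti; first exact: mvmin_lel.
by apply: mvle_min => //; exact: mvle_refl.
Qed.

Lemma mvle_addl_min j x y z : mvle z (mvD j x) -> mvle z (mvD j y) ->
  mvle z (mvD j (mvmin x y)).
Proof. by move=> zx zy; apply/mvB_leP/mvle_min; exact/mvB_leP. Qed.

(** The meet lies below [p + p'] and, being below [q], also below [p + q]; hence below
    [p + min(p', q) = p]. *)
Lemma mvmin_addl_eq0 p p' q : mvmin p q = mv0 -> mvmin p' q = mv0 ->
  mvmin (mvD p p') q = mv0.
Proof.
move=> pq p'q; apply: mvle0; rewrite -pq; set z := mvmin _ _.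
have zq : mvle z q by exact: mvmin_ler.
apply: mvle_min => //; rewrite -[X in mvle _ X]mvD0 -p'q.
apply: mvle_addl_min; first exact: mvmin_lel.
by apply: mvle_trans zq _; exact: mvle_addl.
Qed.

(** Prelinearity. Adding [m] to the meet [d] of [x] and [y] stays below both, hence below [d]; as
    [m <= mvN d], this sum is not truncated and [d] cancels. *)
Lemma mvB_min0 x y : mvmin (mvB x y) (mvB y x) = mv0.
Proof.
set m := mvmin _ _; pose d := mvmin x y.
have dm z t : mvle d z -> mvle d t -> mvle m (mvB z t) -> mvle (mvD d m) z.
  move=> dz dt mzt; rewrite -(mvBK dz); apply: mvleD; first exact: mvle_refl.
  apply: mvle_trans mzt _; apply/mvB_leP.
  by rewrite -{1}(mvBK dz); apply: mvleD => //; exact: mvle_refl.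
have [dx dy] : mvle d x /\ mvle d y by split; [exact: mvmin_lel|exact: mvmin_ler].
have ddm : mvle (mvD d m) d.
  by apply: mvle_min; [apply: dm dx dy _; exact: mvmin_lel
                      |apply: dm dy dx _; exact: mvmin_ler].
have mNd : mvle m (mvN d).
  apply: mvle_trans (mvmin_lel _ _) _; rewrite /mvB; apply/mvleN.
  by apply: mvle_trans dy _; exact: mvle_addl.
rewrite -(mvDK mNd); apply/mvB_eq0; exact: ddm.
Qed.

End MVLattice.

Section PrimeIdeal.
Variable A : mvAlg.
Implicit Types (x y z a p q : A) (I : set A).

Record mv_ideal I : Prop := {
  ideal0 : I mv0;
  ideal_le : forall x y, mvle x y -> I y -> I x;
  idealD : forall x y, I x -> I y -> I (mvD x y) }.

Definition mv_prime I := forall x y, I (mvB x y) \/ I (mvB y x).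

Definition mvmuln n x : A := iter n (mvD x) mv0.

Lemma mvmulnD m n x : mvmuln (m + n) x = mvD (mvmuln m x) (mvmuln n x).
Proof. by elim: m => [|m IH]; rewrite ?mv0D //= IH mvDA. Qed.

Lemma mvmuln_min0l n p q : mvmin p q = mv0 -> mvmin (mvmuln n p) q = mv0.
Proof.
move=> pq; elim: n => [|n IH]; last exact: mvmin_addl_eq0.
by apply: mvmin_l; exact: mv0le.
Qed.

Lemma mvminC x y : mvmin x y = mvmin y x.
Proof. by rewrite /mvmin mvmaxC. Qed.

Lemma ideal_adjoin I p : mv_ideal I ->
  mv_ideal [set z | exists n i, I i /\ mvle z (mvD i (mvmuln n p))].
Proof.
move=> [I0 Il ID]; split.
- by exists 0%N, mv0; split=> //; exact: mv0le.
- by move=> x y xy [n [i [Ii yi]]]; exists n, i; split=> //; exact: mvle_trans yi.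
- move=> x y [n [i [Ii xi]]] [m [k [Ik yk]]]; exists (n + m)%N, (mvD i k).
  split; first exact: ID.
  apply: mvle_trans (mvleD xi yk) _; rewrite mvmulnD.
  rewrite !mvDA (mvDAC i); exact: mvle_refl.
Qed.

(** Zorn's lemma gives an ideal maximal among those avoiding [a]. If it contained neither
    difference, adjoining either one would capture [a]; multiples of the two differences meet in 0,
    so [a] would lie below a sum of two elements of the ideal. *)
Lemma prime_ideal_avoiding a : a <> mv0 ->
  exists I, [/\ mv_ideal I, mv_prime I & ~ I a].
Proof.
move=> a0.
(* The empty chain has empty union, so [P] has to admit the empty set; a maximal element is nonempty
   because the zero ideal also satisfies [P]. *)
pose P I := (I !=set0 -> mv_ideal I) /\ ~ I a.
have [F FP Ftot|I [[Iid Ia] Imax]] := @Zorn_bigcup A P.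
  split=> [[x [X FX Xx]]|[X FX Xa]]; last by have [_] := FP _ FX; apply.
  have id Y y : F Y -> Y y -> mv_ideal Y.
    by move=> FY Yy; apply: (FP _ FY).1; exists y.
  split.
  - by exists X => //; apply: ideal0; exact: id Xx.
  - move=> y z yz [Y FY Yz]; exists Y => //.
    exact: (ideal_le (id _ _ FY Yz) yz).
  - move=> y z [Y FY Yy] [Z FZ Zz]; have [YZ|ZY] := Ftot _ _ FY FZ.
    + by exists Z => //; apply: idealD => //; [exact: id Zz|exact: YZ].
    + by exists Y => //; apply: idealD => //; [exact: id Yy|exact: ZY].
have I0 : I !=set0.
  apply/set0P/negP => /eqP IE; apply: (Imax [set mv0]).
    by rewrite IE; split; [exact: sub0set|move=> /(_ mv0 erefl)].
  split=> [_|/= aE]; last exact: a0.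
  split=> //= x y; first by move=> + yE; rewrite yE; exact: mvle0.
  by move=> -> ->; rewrite mvD0.
have {}Iid := Iid I0; exists I; split=> // x y.
have adj p : ~ I p -> exists n i, I i /\ mvle a (mvD i (mvmuln n p)).
  move=> Ip; apply: contrapT => na.
  apply: (Imax [set z | exists n i, I i /\ mvle z (mvD i (mvmuln n p))]).
    split=> [z Iz|]; first by exists 0%N, z; rewrite mvD0; split=> //; exact: mvle_refl.
    move=> /(_ p) sub; apply/Ip/sub; exists 1%N, mv0.
    split; first exact: ideal0 Iid.
    by rewrite /= mv0D mvD0; exact: mvle_refl.
  by split=> // _; exact: ideal_adjoin.
apply: contrapT => /not_orP[/adj[n [i [Ii ai]]] /adj[m [k [Ik ak]]]].
apply: Ia; apply: (ideal_le Iid (y := mvD i k)); last exact: (idealD Iid).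
rewrite -[X in mvle _ X]mvD0.
rewrite -(_ : mvmin (mvmuln n (mvB x y)) (mvmuln m (mvB y x)) = mv0).
  apply: mvle_addl_min; [apply: mvle_trans ai _|apply: mvle_trans ak _].
    by apply: mvleD; [exact: mvle_addr|exact: mvle_refl].
  by apply: mvleD; [exact: mvle_addl|exact: mvle_refl].
apply: mvmuln_min0l; rewrite mvminC; apply: mvmuln_min0l.
exact: mvB_min0.
Qed.

End PrimeIdeal.

(** * MV-chains and quotients by ideals *)

Record mvChain := MvChain {
  chain_mv :> mvAlg;
  chain_total : forall x y : chain_mv, mvle x y \/ mvle y x;
  chain_nontriv : @mv1 chain_mv <> mv0 }.

Record mv_hom (A B : mvAlg) (h : A -> B) : Prop := {
  mvhom0 : h mv0 = mv0;
  mvhomN : forall x, h (mvN x) = mvN (h x);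
  mvhomD : forall x y, h (mvD x y) = mvD (h x) (h y) }.

Section Quotient.
Variables (A : mvAlg) (I : set A).
Hypotheses (Iid : mv_ideal I).
Implicit Types x y z : A.

Definition ieq x y := I (mvB x y) /\ I (mvB y x).

(** From [x <= (x - y) + y] and [y <= (y - z) + z]. *)
Lemma mvB_triangle x y z : mvle (mvB x z) (mvD (mvB x y) (mvB y z)).
Proof.
apply/mvB_leP; rewrite mvDC -mvDA (mvDC _ z) mvDA.
apply: mvle_trans (mvle_maxl x y) _; rewrite /mvmax -mvDA; apply: mvleD.
  exact: mvle_refl.
by rewrite mvDC; exact: mvle_maxl.
Qed.

Lemma ieq_trans y x z : ieq x y -> ieq y z -> ieq x z.
Proof.
move=> [xy yx] [yz zy]; split; apply: (ideal_le Iid (mvB_triangle _ y _)).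
  exact: idealD.
exact: idealD.
Qed.

Lemma ieq_sym x y : ieq x y -> ieq y x. Proof. by case. Qed.

Lemma ieq_refl x : ieq x x.
Proof. by rewrite /ieq (mvB_eq0 x x).2; [split; exact: ideal0|exact: mvle_refl]. Qed.

Lemma ieqN x y : ieq x y -> ieq (mvN x) (mvN y).
Proof. by rewrite /ieq /mvB !mvNK [mvD x _]mvDC [mvD y _]mvDC => -[]. Qed.

Lemma ieqD x x' y y' : ieq x x' -> ieq y y' -> ieq (mvD x y) (mvD x' y').
Proof.
have key (a b c d : A) : mvle (mvB (mvD a c) (mvD b d)) (mvD (mvB a b) (mvB c d)).
  apply/mvB_leP; rewrite mvDA [X in mvle _ (mvD X _)]mvDAC -mvDA.
  by apply: mvleD; rewrite mvDC; [|rewrite mvDC -[mvD d _]mvDC];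
    exact: mvle_maxl.
move=> [xx' x'x] [yy' y'y]; split.
  by apply: (ideal_le Iid (key x x' y y')); exact: idealD.
by apply: (ideal_le Iid (key x' x y' y)); exact: idealD.
Qed.

Definition quot_car := {X : set A | exists x, X = ieq x}.
Definition quot_pi x : quot_car := exist _ (ieq x) (ex_intro _ x erefl).
Definition quot_repr (X : quot_car) : A := projT1 (cid (svalP X)).

Lemma quot_piP x y : quot_pi x = quot_pi y <-> ieq x y.
Proof.
split=> [/(congr1 sval) /= ->|xy]; first exact: ieq_refl.
apply/eq_exist/predeqP => z; split; apply: ieq_trans => //; exact: ieq_sym.
Qed.

Lemma quot_reprK X : quot_pi (quot_repr X) = X.
Proof.
by rewrite /quot_repr; case: cid => x /= Xx; case: X Xx => X p /= Xx; apply/eq_exist.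
Qed.

Lemma quot_pi_repr x : ieq (quot_repr (quot_pi x)) x.
Proof. exact/quot_piP/quot_reprK. Qed.

Definition quot0 := quot_pi mv0.
Definition quotN X := quot_pi (mvN (quot_repr X)).
Definition quotD X Y := quot_pi (mvD (quot_repr X) (quot_repr Y)).

Lemma quot_piN x : quotN (quot_pi x) = quot_pi (mvN x).
Proof. exact/quot_piP/ieqN/quot_pi_repr. Qed.

Lemma quot_piD x y : quotD (quot_pi x) (quot_pi y) = quot_pi (mvD x y).
Proof. by apply/quot_piP/ieqD; exact: quot_pi_repr. Qed.

Fact quotDA X Y Z : quotD X (quotD Y Z) = quotD (quotD X Y) Z.
Proof.
by rewrite -(quot_reprK X) -(quot_reprK Y) -(quot_reprK Z) !quot_piD mvDA.
Qed.
Fact quotDC X Y : quotD X Y = quotD Y X.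
Proof. by rewrite /quotD mvDC. Qed.
Fact quotD0 X : quotD X quot0 = X.
Proof. by rewrite -(quot_reprK X) quot_piD mvD0. Qed.
Fact quotNK X : quotN (quotN X) = X.
Proof. by rewrite -(quot_reprK X) !quot_piN mvNK. Qed.
Fact quotDN0 X : quotD X (quotN quot0) = quotN quot0.
Proof. by rewrite -(quot_reprK X) quot_piN quot_piD mvDN0. Qed.
Fact quot_luk X Y :
  quotD (quotN (quotD (quotN X) Y)) Y = quotD (quotN (quotD (quotN Y) X)) X.
Proof.
by rewrite -(quot_reprK X) -(quot_reprK Y) !(quot_piD, quot_piN) mv_luk.
Qed.

Definition quot_mv : mvAlg := MvAlg quotDA quotDC quotD0 quotNK quotDN0 quot_luk.

Lemma quot_pi_hom : @mv_hom A quot_mv quot_pi.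
Proof. by split=> // [x|x y]; rewrite /= (quot_piN, quot_piD). Qed.

Lemma quot_pi_eq0 x : quot_pi x = mv0 :> quot_mv <-> I x.
Proof.
have E : mvB x mv0 = x by rewrite /mvB mvD0 mvNK.
split=> [/quot_piP[]|Ix]; first by rewrite E.
apply/quot_piP; split; first by rewrite E.
by rewrite (mvB_eq0 _ _).2; [exact: ideal0|exact: mv0le].
Qed.

Lemma quot_total : mv_prime I ->
  forall x y : quot_mv, mvle x y \/ mvle y x.
Proof.
have le_pi x y : I (mvB x y) -> @mvle quot_mv (quot_pi x) (quot_pi y).
  move=> Ixy; apply/mvB_eq0; rewrite -(quot_pi_eq0 (mvB x y)).2 //.
  by rewrite /mvB /= quot_piN quot_piD quot_piN.
move=> prI X Y; rewrite -(quot_reprK X) -(quot_reprK Y).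
by have [/le_pi|/le_pi] := prI (quot_repr X) (quot_repr Y); [left|right].
Qed.

End Quotient.

Lemma chain_separation (A : mvAlg) (a : A) : a <> mv0 ->
  exists (C : mvChain) (h : A -> C), mv_hom h /\ h a <> mv0.
Proof.
move=> /prime_ideal_avoiding[I [Iid prI Ia]].
have nt : @mv1 (quot_mv Iid) <> mv0.
  rewrite /mv1 /= quot_piN // => /(quot_pi_eq0 Iid) I1.
  by apply/Ia/(ideal_le Iid _ I1); exact: mvle1.
exists (MvChain (@quot_total _ _ Iid prI) nt), (@quot_pi A I); split.
  exact: quot_pi_hom.
by move/(quot_pi_eq0 Iid).
Qed.

(** * The ordered group of an MV-chain *)

Section ChainCarry.
Variable C : mvChain.
Implicit Types a b c d e f x y : C.

Lemma chain_D_neq1 a b : mvD a b <> mv1 -> mvle b (mvN a).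
Proof.
move=> ab; have [//|] := chain_total b (mvN a).
by rewrite /mvle mvNK.
Qed.

Lemma mvD_eq1_split a b : mvD a b = mv1 -> b = mvD (mvN a) (mvM a b).
Proof.
move=> ab; have /mvBK : mvle (mvN a) b by rewrite /mvle mvNK.
by rewrite /mvB /mvM (mvDC (mvN a) (mvN b)).
Qed.

Lemma mvM_absorb a b : mvle b a -> mvM (mvD (mvN a) b) a = b.
Proof. by move=> ba; rewrite /mvM -[RHS](@mvDK _ (mvN a)) ?mvNK. Qed.

(** Both sides are [a + b + c - 1]. Writing [b] as [1 - c] plus the excess [d] of [b + c] over 1
    reduces the claim to cancelling [1 - c]. *)
Lemma chain_modular a b c : mvD a b <> mv1 -> mvD b c = mv1 ->
  mvM (mvD a b) c = mvD a (mvM b c).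
Proof.
move=> ab; rewrite mvDC => bc.
have bE := mvD_eq1_split bc; rewrite (mvMC b c); set d := mvM c b in bE *.
rewrite bE mvDA (mvDC a) -mvDA; apply: mvM_absorb.
have : mvD (mvN c) (mvD a d) <> mv1.
  by rewrite mvDA (mvDC _ a) -mvDA -bE.
by move=> /chain_D_neq1; rewrite mvNK.
Qed.

(** Both sides are the excess of [a + b + c] over 1, and [mv0] when the whole sum stays below 1. *)
Lemma chain_assoc_M a b c : mvD a b <> mv1 -> mvD b c <> mv1 ->
  mvM (mvD a b) c = mvM (mvD c b) a.
Proof.
move=> ab bc.
have [abc|abc] := pselect (mvD (mvD a b) c = mv1); last first.
  have M0 x y : mvD x y <> mv1 -> mvM x y = mv0.
    move=> /chain_D_neq1 /mvleN; rewrite mvNK => xy.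
    by rewrite /mvM (xy : _ = mv1) mvN1.
  by rewrite !M0 // (_ : mvD (mvD c b) a = mvD (mvD a b) c) // mvDAC -mvDA mvDC.
(* With [f := 1 - c - b] and [d := a + b + c - 1] we have [a = f + d]. *)
have c0 : mvN c <> mv1.
  by move=> Nc; apply: ab; rewrite -[RHS]abc -(mvNK c) Nc mvN1 mvD0.
have bNc : mvle b (mvN c) by apply: chain_D_neq1; rewrite mvDC.
set f := mvB (mvN c) b; have bf : mvD b f = mvN c by exact: mvBK.
have NcE : c = mvN (mvD b f) by rewrite bf mvNK.
have abE : mvD a b = mvD (mvN c) (mvM (mvD a b) c).
  by rewrite mvMC; apply: mvD_eq1_split; rewrite mvDC.
set d := mvM _ c in abE *.
have aE : a = mvD f d.
  have bfd : mvD b (mvD f d) <> mv1 by rewrite mvDA bf -abE.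
  rewrite -(mvDK (chain_D_neq1 bfd)) mvDA bf -abE (mvDC a) mvDK //.
  by apply: chain_D_neq1; rewrite mvDC.
have a1 : a <> mv1 by move=> a1; apply: ab; rewrite a1 mv1D.
have cbE : mvD c b = mvN f.
  rewrite NcE mvDC; apply: mvN_inj; rewrite mvNK -[RHS](@mvDK _ b).
    by rewrite /mvB mvDC.
  by apply: chain_D_neq1; rewrite bf.
rewrite cbE mvMC aE -{1}(mvNK f) mvM_absorb //.
by apply: chain_D_neq1; rewrite -aE.
Qed.

(** The De Morgan dual of [chain_assoc_M]. Its side conditions hold after negation when both
    products are nonzero; a zero product is treated directly by [half]. *)
Lemma chain_assoc_D a b c : mvD a b = mv1 -> mvD b c = mv1 ->
  mvD (mvM a b) c = mvD (mvM c b) a.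
Proof.
have half x y z : mvD x y = mv1 -> mvD y z = mv1 -> mvM x y = mv0 ->
    mvD (mvM x y) z = mvD (mvM z y) x.
  move=> xy yz xy0; rewrite xy0 mv0D; move/mvD_eq1_split: xy.
  rewrite xy0 mvD0 => yE; move: yz; rewrite yE => xz.
  by rewrite -{1}(mvBK xz) mvDC /mvM /mvB mvNK.
move=> ab bc; have [M0|ab0] := pselect (mvM a b = mv0); first exact: half.
have [M0|cb0] := pselect (mvM c b = mv0).
  by apply/esym/half; rewrite // mvDC.
apply: mvN_inj.
have := @chain_assoc_M (mvN a) (mvN b) (mvN c).
rewrite /mvM !mvNK; apply.
  by move=> E; apply: ab0; rewrite /mvM E mvN1.
by move=> E; apply: cb0; rewrite /mvM mvDC E mvN1.
Qed.

(** Addition modulo 1: for [a] and [b] below the top, their sum in the group to be built is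
    [carry a b] plus the fractional part [frac a b]. *)
Definition carry a b : bool := `[< mvD a b = mv1 >].
Definition frac a b : C := if carry a b then mvM a b else mvD a b.

Lemma carryC a b : carry a b = carry b a.
Proof. by rewrite /carry mvDC. Qed.

Lemma fracC a b : frac a b = frac b a.
Proof. by rewrite /frac carryC mvDC mvMC. Qed.

Lemma mvM_lel a b : mvle (mvM a b) a.
Proof. by rewrite -{2}(mvNK a); apply/mvleN/mvle_addr. Qed.

Lemma frac_neq1 a b : a <> mv1 -> frac a b <> mv1.
Proof.
move=> a1; rewrite /frac /carry; case: asboolP => // _ ab1; apply: a1.
by apply: mv1le; rewrite -ab1; exact: mvM_lel.
Qed.

(** Associativity, in the form [(a + b) + c = (c + b) + a]. Being symmetric in [a] and [c], it needs
    the case of exactly one carry among the inner sums only once, as [half]. *)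
Lemma carry_fracA a b c : a <> mv1 -> c <> mv1 ->
  (carry a b + carry (frac a b) c = carry c b + carry (frac c b) a)%N /\
  frac (frac a b) c = frac (frac c b) a.
Proof.
have half x y z : x <> mv1 -> mvD x y <> mv1 -> mvD z y = mv1 ->
  (carry x y + carry (frac x y) z = carry z y + carry (frac z y) x)%N /\
  frac (frac x y) z = frac (frac z y) x.
  move=> x1 xy zy; rewrite /frac /carry (asboolF xy) (asboolT zy).
  have xyz : mvD (mvD x y) z = mv1 by rewrite -mvDA (mvDC y) zy mvD1.
  rewrite (asboolT xyz).
  have E : mvM (mvD x y) z = mvD (mvM z y) x.
    by rewrite chain_modular // 1?(mvDC y) // mvDC mvMC.
  (* The outer sum on the right does not carry, because it equals a product lying below [mvD x y],
     which is not the top. *)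
  rewrite -E asboolF // => M1; apply: xy; apply: mv1le.
  by rewrite -M1; exact: mvM_lel.
move=> a1 c1; have [ab|ab] := pselect (mvD a b = mv1);
  have [cb|cb] := pselect (mvD c b = mv1).
- rewrite /frac /carry (asboolT ab) (asboolT cb).
  have -> : mvD (mvM a b) c = mvD (mvM c b) a by apply: chain_assoc_D; rewrite // mvDC.
  by rewrite -!mvMA (mvMC b) (mvMC b) mvMA (mvMC a) -mvMA.
- by have [-> ->] := half c b a c1 cb ab.
- exact: half.
- rewrite /frac /carry (asboolF ab) (asboolF cb).
  have E : mvD (mvD a b) c = mvD (mvD c b) a by rewrite mvDAC -mvDA mvDC.
  by rewrite E chain_assoc_M // mvDC.
Qed.

End ChainCarry.

(* [(m, a)] stands for [m + a]: the fractional part [a] lies in [C] minus its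
   top element, and [m + 1] is encoded as [(m + 1, 0)]. *)
Definition chain_group (C : mvChain) : Type :=
  {classic (int * {a : C | a <> mv1})}.

Definition fpart (C : mvChain) (a : C) (a1 : a <> mv1) : {a : C | a <> mv1} :=
  exist (fun a : C => a <> mv1) a a1.

Section ChainGroup.
Variable C : mvChain.
Implicit Types (x y z : chain_group C) (a b : C).

Fact mv0_neq1 : @mv0 C <> mv1. Proof. by move/esym; exact: chain_nontriv. Qed.

Lemma mvN_neq1 a : a <> mv0 -> mvN a <> mv1.
Proof. by move=> a0 /(congr1 (@mvN C)); rewrite mvNK mvN1. Qed.

Definition cg_add x y : chain_group C :=
  (x.1 + y.1 + carry (sval x.2) (sval y.2),
   fpart (@frac_neq1 C _ (sval y.2) (svalP x.2))).
Definition cg0 : chain_group C := (0, fpart mv0_neq1).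
(** [-(m + a)] is [(-m - 1) + (1 - a)]; for [a = 0] the second term would be the top element, which
    is no fractional part. *)
Definition cg_opp x : chain_group C :=
  match pselect (sval x.2 = mv0) with
  | left _ => (- x.1, fpart mv0_neq1)
  | right a0 => (- x.1 - 1, fpart (mvN_neq1 a0))
  end.

Lemma cg_eq x y : x.1 = y.1 -> sval x.2 = sval y.2 -> x = y.
Proof.
case: x y => [m [a a1]] [n [b b1]] /= -> ab; congr pair.
exact/eq_exist.
Qed.

Fact cg_addC : commutative cg_add.
Proof.
by move=> x y; apply: cg_eq; rewrite /= ?(addrC x.1) 1?carryC // fracC.
Qed.

Fact cg_addA : associative cg_add.
Proof.
move=> x y z; rewrite [RHS]cg_addC (cg_addC y) (cg_addC x (cg_add z y)).
rewrite [RHS]cg_addC.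
have [cE fE] := @carry_fracA C (sval x.2) (sval y.2) (sval z.2)
  (svalP x.2) (svalP z.2).
by apply: cg_eq => //=; lia.
Qed.

Fact cg_add0 : left_id cg0 cg_add.
Proof.
move=> [m [a a1]]; apply: cg_eq; rewrite /= /frac /carry mv0D asboolF //=.
by rewrite add0r addr0.
Qed.

Fact cg_addN : left_inverse cg0 cg_opp cg_add.
Proof.
move=> [m [a a1]]; rewrite /cg_opp /=; case: pselect => /= [a0|a0].
  by apply: cg_eq; rewrite /= /frac /carry a0 mv0D (asboolF mv0_neq1) //=; lia.
apply: cg_eq; rewrite /= /frac /carry mvNx asboolT //=; first by lia.
exact: mvMNx.
Qed.

HB.instance Definition _ := Choice.on (chain_group C).
HB.instance Definition _ := GRing.isZmodule.Build (chain_group C)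
  cg_addA cg_addC cg_add0 cg_addN.

(** The positive cone of the lexicographic order: fractional parts are nonnegative and below 1, so
    the integer part decides the sign. *)
Definition cg_nonneg : set (chain_group C) := [set x | 0 <= x.1].

Lemma cg_nonneg0 : cg_nonneg 0. Proof. by []. Qed.

Lemma cg_nonnegD x y : cg_nonneg x -> cg_nonneg y -> cg_nonneg (x + y).
Proof. by rewrite /cg_nonneg /=; lia. Qed.

Lemma cg_nonneg_anti x : cg_nonneg x -> cg_nonneg (- x) -> x = 0.
Proof.
rewrite /cg_nonneg /= [- x]/(cg_opp x) /cg_opp; case: pselect => /= [a0 m0 m1|_].
  by apply: cg_eq => //=; lia.
by lia.
Qed.

Definition cg_embed a : chain_group C :=
  match pselect (a = mv1) with
  | left _ => (1, fpart mv0_neq1)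
  | right a1 => (0, fpart a1)
  end.

Lemma cg_embed1 : cg_embed mv1 = (1, fpart mv0_neq1).
Proof. by rewrite /cg_embed; case: pselect. Qed.

Lemma cg_embedE a (a1 : a <> mv1) : cg_embed a = (0, fpart a1).
Proof. by rewrite /cg_embed; case: pselect => // a1'; exact: cg_eq. Qed.

Lemma cg_embed0 : cg_embed mv0 = 0.
Proof. exact: cg_embedE. Qed.

Lemma cg_embed_nonneg a : cg_nonneg (cg_embed a).
Proof. by rewrite /cg_embed; case: pselect. Qed.

Lemma cg_embed_eq0 a : cg_embed a = 0 -> a = mv0.
Proof.
rewrite /cg_embed; case: pselect => [_ /(congr1 fst)|a1 /(congr1 snd)] //=.
by move/(congr1 sval).
Qed.

Lemma cg_embedD a b : mvD a b <> mv1 ->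
  cg_embed (mvD a b) = cg_embed a + cg_embed b.
Proof.
move=> ab; have a1 : a <> mv1 by move=> a1; apply: ab; rewrite a1 mv1D.
have b1 : b <> mv1 by move=> b1; apply: ab; rewrite b1 mvD1.
by rewrite !cg_embedE; apply: cg_eq; rewrite /= /frac /carry (asboolF ab).
Qed.

Lemma cg_embedD1 a b : mvD a b = mv1 ->
  cg_embed a + cg_embed b = cg_embed mv1 + cg_embed (mvM a b).
Proof.
have M1 c : mvM mv1 c = c by rewrite /mvM mvN1 mv0D mvNK.
move=> ab; have [->|a1] := pselect (a = mv1); first by rewrite M1.
have [->|b1] := pselect (b = mv1); first by rewrite mvMC M1 addrC.
have M_neq1 : mvM a b <> mv1.
  by have := @frac_neq1 C a b a1; rewrite /frac /carry asboolT.
rewrite cg_embed1 !cg_embedE; apply: cg_eq.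
  by rewrite /= /carry mv0D (asboolF M_neq1) (asboolT ab).
by rewrite /= /frac /carry mv0D (asboolF M_neq1) (asboolT ab).
Qed.

Lemma cg_embedN a : cg_embed (mvN a) = cg_embed mv1 - cg_embed a.
Proof.
by apply/eqP; rewrite eq_sym subr_eq cg_embedD1 ?mvNx // mvMNx cg_embed0 addr0.
Qed.

End ChainGroup.

(** * Fourier-Motzkin elimination *)

Section LinearForms.
Variable V : zmodType.
Implicit Types (c d : nat -> int) (x y : nat -> V).

(** Integer coefficients let one form be evaluated both in the group of a chain and in the reals;
    families over [nat] allow [n] to vary without casts. *)
Definition lform n c x : V := \sum_(i < n) x i *~ c i.

Lemma lform_lin n c d p q x :
  lform n (fun i => p * c i + q * d i) x = lform n c x *~ p + lform n d x *~ q.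
Proof.
rewrite /lform !mulrz_suml -big_split; apply: eq_bigr => i _ /=.
by rewrite mulrzDr !mulrzA mulrzAC (mulrzAC _ q).
Qed.

Lemma lform0 n x : lform n (fun=> 0) x = 0.
Proof. by rewrite /lform big1 // => i _; rewrite mulr0z. Qed.

Lemma lform_delta n k x : (k < n)%N -> lform n (fun i => (i == k)%:Z) x = x k.
Proof.
move=> kn; rewrite /lform (bigD1 (Ordinal kn)) //= eqxx mulr1z big1 ?addr0 //.
by move=> i; rewrite -val_eqE /= => /negbTE ->; rewrite mulr0z.
Qed.

Lemma lformD n c d x : lform n (fun i => c i + d i) x = lform n c x + lform n d x.
Proof. by rewrite /lform -big_split; apply: eq_bigr => i _; rewrite mulrzDr. Qed.

Lemma lformB n c d x : lform n (fun i => c i - d i) x = lform n c x - lform n d x.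
Proof.
by rewrite /lform -sumrB; apply: eq_bigr => i _; rewrite mulrzDr mulrNz.
Qed.

End LinearForms.

(** [N] stands for a positive cone, and [s] tells whether the constraint is strict. *)
Definition csat (V : zmodType) (N : set V) (s : bool) (z : V) :=
  N z /\ (s -> z <> 0).

Section Cone.
Variables (V : zmodType) (N : set V).
Hypothesis ND : forall x y, N x -> N y -> N (x + y).
Hypothesis Nanti : forall x, N x -> N (- x) -> x = 0.

Lemma csatD s t x y : csat N s x -> csat N t y -> csat N (s || t) (x + y).
Proof.
move=> [Nx sx] [Ny ty]; split; first exact: ND.
move=> /orP st xy0; have yE : y = - x by apply/eqP; rewrite -addr_eq0 addrC xy0.
have x0 : x = 0 by apply: Nanti => //; rewrite -yE.
by case: st => [/sx|/ty] //; rewrite yE x0 oppr0.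
Qed.

Lemma csatMz s x (p : int) : 0 < p -> csat N s x -> csat N s (x *~ p).
Proof.
case: p => [[|p]|] // _ sx; elim: p => [|p IH]; first by rewrite mulr1z.
by rewrite -(addn1 p.+1) PoszD mulrzDr mulr1z -(orbb s); exact: csatD.
Qed.

End Cone.

Section FourierMotzkin.
Variable R : realFieldType.

(** Only the largest lower bound and the smallest upper bound matter. Their midpoint works if they
    are apart; if they touch, [vlt] forces every bound attained there to be non-strict. *)
Lemma between_bounds (I : finType) (lo up s : pred I) (v : I -> R) :
  (forall i j, lo i -> up j -> v i < v j ?<= if ~~ (s i || s j)) ->
  exists x, (forall i, lo i -> v i < x ?<= if ~~ s i) /\
            (forall j, up j -> x < v j ?<= if ~~ s j).
Proof.
move=> vlt; have [[i0 loi0]|nlo] := pselect (exists i, lo i); last first.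
  have [[j0 upj0]|nup] := pselect (exists j, up j); last first.
    by exists 0; split=> i hi; [case: nlo|case: nup]; exists i.
  case: (arg_minP v upj0) => j upj vj.
  exists (v j - 1); split=> k hk; first by case: nlo; exists k.
  by apply/lteifS/(lt_le_trans _ (vj k hk)); rewrite gtrBl.
case: (arg_maxP v loi0) => i loi vi.
have [[j0 upj0]|nup] := pselect (exists j, up j); last first.
  exists (v i + 1); split=> k hk; last by case: nup; exists k.
  by apply/lteifS/(le_lt_trans (vi k hk)); rewrite ltrDl.
case: (arg_minP v upj0) => j upj vj.
have [ij|ji] := ltP (v i) (v j).
  exists ((v i + v j) / 2); split=> k hk.
    by have := vi _ hk; rewrite /= => ?; apply/lteifS; lra.
  by have := vj _ hk; rewrite /= => ?; apply/lteifS; lra.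
exists (v i); split=> k hk.
  have := vlt _ _ hk upj; have /= := vi _ hk.
  by case: (s k) => //= _ kj; exact: lt_le_trans ji.
have := vlt _ _ loi hk.
by case: (s k) => //=; rewrite ?orbT //= orbF; case: (s i) => //= /ltW.
Qed.

Variables (V : zmodType) (N : set V).
Hypothesis N0 : N 0.
Hypothesis ND : forall x y, N x -> N y -> N (x + y).
Hypothesis Nanti : forall x, N x -> N (- x) -> x = 0.

(** The last unknown is eliminated by positive combinations of constraints in which its coefficients
    have opposite signs. These still hold at [g], and a real solution of the smaller system leaves
    room for the last unknown. *)
Theorem fourier_motzkin n (I : finType) (s : pred I) (c : I -> nat -> int)
    (g : nat -> V) :
  (forall i, csat N (s i) (lform n (c i) g)) ->
  exists r : nat -> R, forall i, 0 < lform n (c i) r ?<= if ~~ s i.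
Proof.
elim: n I s c => [|n IH] I s c cg.
  exists (fun=> 0) => i; have [_] := cg i; rewrite /lform !big_ord0.
  by case: (s i) => //= /(_ isT).
(* The new system is indexed by all pairs and all single constraints; indices that yield no
   consequence free of the last unknown carry the trivial non-strict form 0. *)
pose opp i j := (0 < c i n) && (c j n < 0).
pose s' (k : I * I + I) := match k with
  | inl (i, j) => opp i j && (s i || s j)
  | inr i => (c i n == 0) && s i end.
pose c' (k : I * I + I) : nat -> int := match k with
  | inl (i, j) => if opp i j then fun l => - c j n * c i l + c i n * c j l
                  else fun=> 0
  | inr i => if c i n == 0 then c i else fun=> 0 end.
have lformS (W : zmodType) i (x : nat -> W) :
    lform n.+1 (c i) x = lform n (c i) x + x n *~ c i n.
  by rewrite /lform big_ord_recr.
have [k|r rP] := IH _ s' c'.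
  case: k => [[i j]|i] /=.
    case: ifP => [/andP[ci cj]|_]; last by rewrite lform0; split.
    have := csatD ND Nanti (csatMz ND Nanti (p := - c j n) _ (cg i))
      (csatMz ND Nanti ci (cg j)).
    rewrite oppr_gt0 => /(_ cj); rewrite !lformS lform_lin /=.
    rewrite !mulrzDl -!mulrzA addrACA -mulrzDr.
    by rewrite mulrN mulrC addNr mulr0z addr0.
  case: eqP => [ci|_]; last by rewrite lform0; split.
  by have := cg i; rewrite lformS ci mulr0z addr0.
(* The bound that constraint [i] puts on the last unknown: a lower one for a positive coefficient,
   an upper one for a negative coefficient. *)
pose v i := - lform n (c i) r / (c i n)%:~R.
have [i j /= ci cj|x [xlo xup]] :=
    @between_bounds I (fun i => 0 < c i n) (fun j => c j n < 0) s v.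
  have := rP (inl (i, j)); rewrite /= /opp ci cj /= lform_lin /v.
  have {}ci : (0 : R) < (c i n)%:~R by rewrite ltr0z.
  have {}cj : (c j n)%:~R < (0 : R) by rewrite ltrz0.
  rewrite -(mulrzr (lform n (c i) r)) -(mulrzr (lform n (c j) r)) mulrNz => H.
  rewrite lteif_pdivrMr // mulrAC lteif_ndivlMr //.
  move: H; case: (s i || s j) => /=; lra.
exists (fun k => if k == n then x else r k) => i.
rewrite lformS eqxx -(mulrzr x).
have -> : lform n (c i) (fun k => if k == n then x else r k) = lform n (c i) r.
  by apply: eq_bigr => k _; rewrite ltn_eqF.
have [ci|ci|ci] := ltrgt0P (c i n).
- have := xlo _ ci; rewrite /v.
  have {}ci : (0 : R) < (c i n)%:~R by rewrite ltr0z.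
  rewrite lteif_pdivrMr //; case: (s i) => /=; lra.
- have := xup _ ci; rewrite /v.
  have {}ci : (c i n)%:~R < (0 : R) by rewrite ltrz0.
  rewrite lteif_ndivlMr //; case: (s i) => /=; lra.
- by have := rP (inr i); rewrite /= ci eqxx /= mulr0z mulr0 addr0.
Qed.

End FourierMotzkin.

(** * Chang's completeness theorem *)

Inductive mvterm (X : Type) :=
  | TVar of X
  | TZero
  | TNeg of mvterm X
  | TAdd of mvterm X & mvterm X.
Arguments TZero {X}.

Section Terms.
Variable X : Type.

Fixpoint mveval (A : mvAlg) (v : X -> A) (t : mvterm X) : A :=
  match t with
  | TVar x => v x
  | TZero => mv0
  | TNeg t => mvN (mveval v t)
  | TAdd t1 t2 => mvD (mveval v t1) (mveval v t2)
  end.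

Fixpoint tsubst (Y : Type) (f : X -> mvterm Y) (t : mvterm X) : mvterm Y :=
  match t with
  | TVar x => f x
  | TZero => TZero
  | TNeg t => TNeg (tsubst f t)
  | TAdd t1 t2 => TAdd (tsubst f t1) (tsubst f t2)
  end.

(** [{classic X}] supplies the equality test behind membership and [index]. *)
Fixpoint tvars (t : mvterm X) : seq {classic X} :=
  match t with
  | TVar x => [:: x]
  | TZero => [::]
  | TNeg t => tvars t
  | TAdd t1 t2 => tvars t1 ++ tvars t2
  end.

Definition tminus (s t : mvterm X) := TNeg (TAdd (TNeg s) t).
Definition tmax (s t : mvterm X) := TAdd (tminus s t) t.
Definition tmin (s t : mvterm X) := TNeg (tmax (TNeg s) (TNeg t)).

End Terms.

Section TermTheory.
Variable X : Type.

Lemma mveval_subst (Y : Type) (A : mvAlg) (f : X -> mvterm Y) (v : Y -> A) t :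
  mveval v (tsubst f t) = mveval (fun x => mveval v (f x)) t.
Proof. by elim: t => //= [t ->|t1 -> t2 ->]. Qed.

Lemma eq_mveval (A : mvAlg) (v w : X -> A) t :
  (forall x : {classic X}, x \in tvars t -> v x = w x) ->
  mveval v t = mveval w t.
Proof.
elim: t => //= [x|t IH|t1 IH1 t2 IH2] vw.
- by apply: vw; rewrite inE.
- by rewrite IH.
- by rewrite IH1 ?IH2 // => x xt; apply: vw; rewrite mem_cat xt ?orbT.
Qed.

Lemma mveval_hom (A B : mvAlg) (h : A -> B) (v : X -> A) t : mv_hom h ->
  h (mveval v t) = mveval (fun x => h (v x)) t.
Proof.
move=> [h0 hN hD]; elim: t => //= [t IH|t1 IH1 t2 IH2].
  by rewrite hN IH.
by rewrite hD IH1 IH2.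
Qed.

End TermTheory.

(** * From terms over a chain to integer linear systems *)

Section Linearization.
Variables (R : realType) (C : mvChain) (v : nat -> C).

(* Coordinate [0] carries the unit of the group, coordinate [k + 1] the value of
   the [k]-th variable. *)
Let g k : chain_group C := if k is k'.+1 then cg_embed (v k') else cg_embed mv1.
Let pt (w : nat -> unitI R) k : R := if k is k'.+1 then sval (w k') else 1.

(* At the point [v] every subterm takes the value of one linear form, and the
   choices between the two branches of the truncated sums are linear
   constraints. *)
Lemma linearize n (t : mvterm nat) : (forall k, k \in tvars t -> (k < n)%N) ->
  exists (L : nat -> int) (I : finType) (c : I -> nat -> int),
  [/\ cg_embed (mveval v t) = lform n.+1 L g,
      forall i, cg_nonneg (lform n.+1 (c i) g) &
      forall w, (forall i, 0 <= lform n.+1 (c i) (pt w)) ->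
        sval (mveval (A := unitI_mv R) w t) = lform n.+1 L (pt w)].
Proof.
elim: t => /= [k||t IH|t1 IH1 t2 IH2] tn.
- exists (fun i => (i == k.+1)%:Z), void, (fun=> fun=> 0).
  have kn : (k.+1 < n.+1)%N by rewrite ltnS; apply: tn; rewrite inE.
  by split=> [|[]|w _]; rewrite lform_delta.
- exists (fun=> 0), void, (fun=> fun=> 0).
  by split=> [|[]|w _]; rewrite lform0 ?cg_embed0.
- have [L [I [c [LE cN Lw]]]] := IH tn.
  exists (fun i => (i == 0%N)%:Z - L i), I, c; split=> // [|w /Lw wE].
    by rewrite cg_embedN LE lformB lform_delta.
  by rewrite /= wE lformB lform_delta.
- have [k kt1|L1 [I1 [c1 [LE1 cN1 Lw1]]]] := IH1.
    by apply: tn; rewrite mem_cat kt1.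
  have [k kt2|L2 [I2 [c2 [LE2 cN2 Lw2]]]] := IH2.
    by apply: tn; rewrite mem_cat kt2 orbT.
  pose c d (i : I1 + I2 + unit) := match i with
    | inl (inl i) => c1 i | inl (inr i) => c2 i | inr _ => d end.
  (* If the sum reaches 1 at [v], its form is the unit and [L1 + L2 - 1 >= 0] is recorded; otherwise
     its form is [L1 + L2], with the opposite constraint. *)
  have [t12|t12] := pselect (mvD (mveval v t1) (mveval v t2) = mv1).
    exists (fun i => (i == 0%N)%:Z), (I1 + I2 + unit)%type,
      (c (fun i => L1 i + L2 i - (i == 0%N)%:Z)).
    split=> [|[[i|i]|[]]|w wc] //=.
    + by rewrite t12 lform_delta.
    + rewrite lformB lform_delta // lformD -LE1 -LE2 cg_embedD1 //=.
      by rewrite addrAC subrr add0r; exact: cg_embed_nonneg.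
    + rewrite lform_delta //= Lw1 => [|i]; last exact: (wc (inl (inl i))).
      rewrite Lw2 => [|i]; last exact: (wc (inl (inr i))).
      have := wc (inr tt); rewrite /= lformB lform_delta // lformD /=.
      by rewrite subr_ge0 => ?; apply/min_idPl.
  exists (fun i => L1 i + L2 i), (I1 + I2 + unit)%type,
    (c (fun i => (i == 0%N)%:Z - (L1 i + L2 i))).
  split=> [|[[i|i]|[]]|w wc] //=.
  + by rewrite cg_embedD // LE1 LE2 lformD.
  + rewrite lformB lform_delta // lformD -LE1 -LE2 -cg_embedD //= -cg_embedN.
    exact: cg_embed_nonneg.
  + rewrite lformD Lw1 => [|i]; last exact: (wc (inl (inl i))).
    rewrite Lw2 => [|i]; last exact: (wc (inl (inr i))).
    have := wc (inr tt); rewrite /= lformB lform_delta // lformD /=.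
    by rewrite subr_ge0 => ?; apply/min_idPr.
Qed.

(** The system says that all branches are as at [v], the variables lie between 0 and the unit, and
    both the unit and the value of [t] are strictly positive. Being homogeneous, a real solution can
    be divided by its unit [r 0] to give a point of the cube. *)
Lemma chain_term_refute (t : mvterm nat) : mveval v t <> mv0 ->
  exists w : nat -> unitI R, mveval (A := unitI_mv R) w t <> mv0.
Proof.
move=> vt; pose n := (\max_(k <- tvars t) (k : nat)).+1.
have tn k : k \in tvars t -> (k < n)%N.
  move=> kt; rewrite ltnS.
  exact: (@leq_bigmax_seq {classic nat} (tvars t) xpredT (fun k => k) k kt isT).
have [L [I [c [LE cN Lw]]]] := linearize tn.
pose s (i : I + bool + ('I_n * bool)) := if i is inl (inr _) then true else false.
pose c' (i : I + bool + ('I_n * bool)) : nat -> int := match i with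
  | inl (inl i) => c i
  | inl (inr true) => L
  | inl (inr false) => fun j => (j == 0%N)%:Z
  | inr (k, true) => fun j => (j == k.+1)%:Z
  | inr (k, false) => fun j => (j == 0%N)%:Z - (j == k.+1)%:Z end.
have kn (k : 'I_n) : (k.+1 < n.+1)%N by rewrite ltnS.
have [i|r rP] := @fourier_motzkin R _ _ (@cg_nonneg0 C) (@cg_nonnegD C)
    (@cg_nonneg_anti C) n.+1 _ s c' g.
  case: i => [[i|[]]|[k []]]; rewrite /csat /= ?lformB ?lform_delta ?kn //= -?LE.
  - by split=> [|_ /cg_embed_eq0]; [exact: cg_embed_nonneg|].
  - split=> [|_ /cg_embed_eq0]; [exact: cg_embed_nonneg|].
    exact: chain_nontriv.
  - by split=> //; exact: cg_embed_nonneg.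
  - by rewrite -cg_embedN; split=> //; exact: cg_embed_nonneg.
have r0 : 0 < r 0%N by have := rP (inl (inr false)); rewrite /= lform_delta.
have rk (k : 'I_n) : 0 <= r k.+1 / r 0%N <= 1.
  have := rP (inr (k, true)); have := rP (inr (k, false)).
  rewrite /= lformB !lform_delta ?kn //= => rk1 rk0.
  apply/andP; split; first by rewrite divr_ge0 // ltW.
  by rewrite ler_pdivrMr // mul1r -subr_ge0.
pose w k : unitI R := if insub k is Some k
  then exist (fun x : R => 0 <= x <= 1) _ (rk k) else u0 R.
have ptE d : lform n.+1 d (pt w) = lform n.+1 d r / r 0%N.
  rewrite /lform mulr_suml; apply: eq_bigr => -[[|k] lt_kn] _ /=.
    by rewrite mulrzAl divff // gt_eqF.
  by rewrite /w insubT /= mulrzAl.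
exists w => /(congr1 sval); rewrite Lw => [/= /eqP|i]; rewrite ptE.
  have /= L0 := rP (inl (inr true)).
  by rewrite mulf_eq0 invr_eq0 !gt_eqF.
by rewrite divr_ge0 ?(ltW r0) //; exact: (rP (inl (inl i))).
Qed.

End Linearization.

Theorem chang_completeness (R : realType) (X : Type) (x0 : X) (s t : mvterm X) :
  (forall w : X -> unitI R,
    mveval (A := unitI_mv R) w s = mveval (A := unitI_mv R) w t) ->
  forall (A : mvAlg) (v : X -> A), mveval v s = mveval v t.
Proof.
have zero (r : mvterm X) :
    (forall w : X -> unitI R, mveval (A := unitI_mv R) w r = mv0) ->
    forall (A : mvAlg) (v : X -> A), mveval v r = mv0.
  move=> r0 A v; apply: contrapT => /chain_separation[C [h [hom]]].
  rewrite (mveval_hom _ _ hom).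
  (* Variables are renamed to their positions in [tvars r], since [chain_term_refute] speaks of
     variables in [nat]; [x0] is only the default of [nth]. *)
  pose idx (x : X) := index (x : {classic X}) (tvars r).
  pose v' k : C := h (v (nth (x0 : {classic X}) (tvars r) k)).
  have -> : mveval (fun x => h (v x)) r = mveval v' (tsubst (fun x => TVar (idx x)) r).
    by rewrite mveval_subst; apply: eq_mveval => x xr; rewrite /v' /= nth_index.
  move=> /(@chain_term_refute R C _ _)[w]; rewrite mveval_subst; apply.
  exact: r0.
move=> st A v.
have le (r q : mvterm X) :
    (forall w : X -> unitI R,
      mveval (A := unitI_mv R) w r = mveval (A := unitI_mv R) w q) ->
    mvle (mveval v r) (mveval v q).
  move=> rq; apply/mvB_eq0; apply: (zero (tminus r q)) => w.
  apply/(mvB_eq0 (A := unitI_mv R) (mveval _ r) (mveval _ q)).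
  by rewrite rq; exact: mvle_refl.
by apply: mvle_anti; apply: le => w; rewrite st.
Qed.

(** * McNaughton's theorem *)

(** Innermost [min] and [max] are split first, so that every case hypothesis is free of them. *)
Ltac minmax_lra :=
  repeat match goal with
  | |- context [Order.min ?a ?b] =>
    lazymatch constr:((a, b)) with
    | context [Order.min _ _] => fail
    | context [Order.max _ _] => fail
    | _ => case: (leP a b) => ?
    end
  | |- context [Order.max ?a ?b] =>
    lazymatch constr:((a, b)) with
    | context [Order.min _ _] => fail
    | context [Order.max _ _] => fail
    | _ => case: (leP a b) => ?
    end
  end; lra.

Section TermFunctions.
Variables (R : realType) (X : Type).
Implicit Types (f g : (X -> unitI R) -> R) (w : X -> unitI R).

Definition term_fun f :=
  exists t : mvterm X, forall w, sval (mveval (A := unitI_mv R) w t) = f w.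

Lemma eq_term_fun f g : (forall w, f w = g w) -> term_fun f -> term_fun g.
Proof. by move=> fg [t tE]; exists t => w; rewrite tE. Qed.

Lemma unitI_ge0 (x : unitI R) : 0 <= sval x.
Proof. by case: x => x /= /andP[]. Qed.

Lemma unitI_le1 (x : unitI R) : sval x <= 1.
Proof. by case: x => x /= /andP[]. Qed.

Lemma term_fun_range f w : term_fun f -> 0 <= f w <= 1.
Proof. by move=> [t <-]; rewrite unitI_ge0 unitI_le1. Qed.

Lemma term_fun_coord x : term_fun (fun w => sval (w x)).
Proof. by exists (TVar x). Qed.

Lemma term_fun0 : term_fun (fun=> 0). Proof. by exists TZero. Qed.

Lemma term_funN f : term_fun f -> term_fun (fun w => 1 - f w).
Proof. by move=> [t tE]; exists (TNeg t) => w; rewrite /= tE. Qed.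

Lemma term_fun1 : term_fun (fun=> 1).
Proof. by apply: eq_term_fun (term_funN term_fun0) => w; rewrite subr0. Qed.

Lemma term_funD f g : term_fun f -> term_fun g ->
  term_fun (fun w => Num.min 1 (f w + g w)).
Proof.
by move=> [t tE] [s sE]; exists (TAdd t s) => w; rewrite /= tE sE.
Qed.

Lemma term_funM f g : term_fun f -> term_fun g ->
  term_fun (fun w => Num.max 0 (f w + g w - 1)).
Proof.
move=> tf tg; apply: eq_term_fun (term_funN (term_funD (term_funN tf) (term_funN tg))).
move=> w; have /andP[? ?] := term_fun_range w tf.
have /andP[? ?] := term_fun_range w tg.
by minmax_lra.
Qed.

Lemma term_fun_max f g : term_fun f -> term_fun g ->
  term_fun (fun w => Num.max (f w) (g w)).
Proof.
move=> tf tg.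
apply: eq_term_fun (term_funD (term_funN (term_funD (term_funN tf) tg)) tg).
move=> w; have /andP[? ?] := term_fun_range w tf.
have /andP[? ?] := term_fun_range w tg.
by minmax_lra.
Qed.

Lemma term_fun_min f g : term_fun f -> term_fun g ->
  term_fun (fun w => Num.min (f w) (g w)).
Proof.
move=> tf tg.
apply: eq_term_fun (term_funN (term_fun_max (term_funN tf) (term_funN tg))).
by move=> w; minmax_lra.
Qed.

Lemma term_fun_bigmax (I : Type) (r : seq I) (P : pred I)
    (F : I -> (X -> unitI R) -> R) :
  (forall i, term_fun (F i)) ->
  term_fun (fun w => \big[Num.max/0]_(i <- r | P i) F i w).
Proof.
move=> tF; elim: r => [|i r IH].
  by apply: eq_term_fun term_fun0 => w; rewrite big_nil.
case Pi : (P i); last by apply: eq_term_fun IH => w; rewrite big_cons Pi.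
by apply: eq_term_fun (term_fun_max (tF i) IH) => w; rewrite big_cons Pi.
Qed.

Lemma term_fun_bigmin (I : Type) (r : seq I) (P : pred I)
    (F : I -> (X -> unitI R) -> R) :
  (forall i, term_fun (F i)) ->
  term_fun (fun w => \big[Num.min/1]_(i <- r | P i) F i w).
Proof.
move=> tF; elim: r => [|i r IH].
  by apply: eq_term_fun term_fun1 => w; rewrite big_nil.
case Pi : (P i); last by apply: eq_term_fun IH => w; rewrite big_cons Pi.
by apply: eq_term_fun (term_fun_min (tF i) IH) => w; rewrite big_cons Pi.
Qed.

Definition clamp (z : R) : R := Num.max 0 (Num.min 1 z).

(** All integer shifts are taken at once because the recursion for one shift calls on the next. *)
Definition clamp_term f := forall b : int, term_fun (fun w => clamp (f w + b%:~R)).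

Lemma eq_clamp_term f g : (forall w, f w = g w) -> clamp_term f -> clamp_term g.
Proof. by move=> fg cf b; apply: eq_term_fun (cf b) => w; rewrite fg. Qed.

Lemma clamp_term0 : clamp_term (fun=> 0).
Proof.
move=> b; have [b0|b0] := leP b 0.
  apply: eq_term_fun term_fun0 => w; rewrite add0r /clamp.
  have : b%:~R <= 0 :> R by rewrite lerz0.
  by minmax_lra.
apply: eq_term_fun term_fun1 => w; rewrite add0r /clamp.
have : 1 <= b%:~R :> R by rewrite ler1z.
by minmax_lra.
Qed.

(* Rose and Rosser: for [0 <= x <= 1], the clamp of [z + x] is
   [(clamp z (+) x) (.) clamp (z + 1)]. *)
Lemma clamp_termD f x : clamp_term f -> clamp_term (fun w => f w + sval (w x)).
Proof.
move=> cf b; have := term_funM (term_funD (cf b) (term_fun_coord x)) (cf (b + 1)).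
apply: eq_term_fun => w; rewrite intrD /clamp.
have := unitI_ge0 (w x); have := unitI_le1 (w x).
by minmax_lra.
Qed.

Lemma clamp_termN f : clamp_term f -> clamp_term (fun w => - f w).
Proof.
move=> cf b; apply: eq_term_fun (term_funN (cf (1 - b))) => w.
rewrite intrB /clamp.
by minmax_lra.
Qed.

Lemma clamp_termDMz f (a : int) x : clamp_term f ->
  clamp_term (fun w => f w + a%:~R * sval (w x)).
Proof.
have nat_case g (n : nat) : clamp_term g ->
    clamp_term (fun w => g w + n%:R * sval (w x)).
  move=> cg; elim: n => [|n IH].
    by apply: eq_clamp_term cg => w; rewrite mul0r addr0.
  apply: eq_clamp_term (clamp_termD x IH) => w.
  by rewrite -addrA -[n.+1]addn1 natrD mulrDl mul1r.
move=> cf; case: a => n.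
  by apply: eq_clamp_term (nat_case f n cf) => w; rewrite pmulrn.
apply: eq_clamp_term (clamp_termN (nat_case _ n.+1 (clamp_termN cf))) => w.
by rewrite opprD opprK NegzE mulrNz -pmulrn mulNr.
Qed.

Lemma clamp_affine (I : Type) (r : seq I) (a : I -> int) (x : I -> X) (b : int) :
  term_fun (fun w => clamp (\sum_(i <- r) (a i)%:~R * sval (w (x i)) + b%:~R)).
Proof.
suff : clamp_term (fun w => \sum_(i <- r) (a i)%:~R * sval (w (x i))) by [].
elim: r => [|i r IH].
  by apply: eq_clamp_term clamp_term0 => w; rewrite big_nil.
apply: eq_clamp_term (clamp_termDMz (a i) (x i) IH) => w.
by rewrite big_cons addrC.
Qed.

End TermFunctions.

(** * Piecewise linear functions of one variable *)

Section PieceCrossing.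
Variables (R : realType) (m : nat) (h : R -> R) (a b : 'I_m -> R).
Hypothesis hcont : forall t0 e, 0 <= t0 <= 1 -> 0 < e ->
  exists2 d, 0 < d & forall t, 0 <= t <= 1 -> `|t - t0| < d -> `|h t - h t0| < e.
Hypothesis hpieces : forall t, 0 <= t <= 1 -> exists j, h t = a j + b j * t.

(** A piece that differs from [h] at [t0] differs from it on a neighbourhood, by continuity. There
    are finitely many pieces, so close enough to [t0] only pieces agreeing with [h] at [t0] can be
    active. *)
Lemma piece_accumulation (P : set R) t0 : 0 <= t0 <= 1 ->
  (forall t, P t -> 0 <= t <= 1) ->
  (forall d, 0 < d -> exists2 t, P t & `|t - t0| < d) ->
  exists j t, [/\ P t, h t = a j + b j * t & h t0 = a j + b j * t0].
Proof.
move=> t0I PI Pacc; apply: contrapT => none.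
have far j : exists d, 0 < d /\
    forall t, P t -> `|t - t0| < d -> h t <> a j + b j * t.
  have [jt0|/eqP jt0] := eqVneq (h t0) (a j + b j * t0).
    by exists 1; split=> // t Pt _ ht; apply: none; exists j, t.
  (* Half the gap at [t0]: [h] and the piece each move by less than [e], so they cannot meet. *)
  have [e eE] : exists e, e = `|h t0 - (a j + b j * t0)| / 2.
    by exists (`|h t0 - (a j + b j * t0)| / 2).
  have e0 : 0 < e by rewrite eE divr_gt0 // normr_gt0 subr_eq0; exact/eqP.
  have [d d0 dP] := hcont t0I e0.
  have b1 : 0 < `|b j| + 1 by rewrite ltr_wpDl.
  exists (Num.min d (e / (`|b j| + 1))); split.
    by rewrite lt_min d0 divr_gt0.
  move=> t Pt; rewrite lt_min ltr_pdivlMr // => /andP[td tb] ht.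
  have := dP _ (PI _ Pt) td; rewrite ht.
  have : `|b j * (t - t0)| < e.
    by apply: le_lt_trans tb; rewrite normrM mulrC ler_wpM2l // lerDl.
  have := ler_normD (b j * (t - t0)) (- (a j + b j * t - h t0)).
  rewrite normrN (_ : _ + - _ = h t0 - (a j + b j * t0)); last by ring.
  by lra.
have [d dP] := choice far.
have [|t Pt] := Pacc (\big[Num.min/1]_j d j).
  by apply: lt_bigmin => // j _; case: (dP j).
move=> td; have [j] := hpieces (PI _ Pt).
have [_ /(_ t Pt)] := dP j; apply.
exact: lt_le_trans td (bigmin_le _ _ _).
Qed.

(** If [h >= 0] throughout, a piece active at 1 and at some earlier point has slope at most 0 and
    vanishes at 1. Otherwise let [t0] be the infimum of the points where [h < 0]: a piece active at
    [t0] and at a later such point decreases from a value [>= 0] to a negative one. *)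
Lemma piece_crossing : h 0 = 0 -> h 1 = 0 ->
  exists j, 0 <= a j /\ a j + b j <= 0.
Proof.
move=> h0 h1.
have [hge0|/existsNP[s /not_implyP[sI /negP]]] :=
    pselect (forall t, 0 <= t <= 1 -> 0 <= h t).
  have [||d d0|j [t [/= /andP[t0 t1] ht h1j]]] :=
      @piece_accumulation [set t | 0 <= t < 1] 1.
  - by rewrite ler01 lexx.
  - by move=> t /= /andP[-> /ltW].
  - exists (Num.max 0 (1 - d / 2)) => /=.
      by rewrite le_max lexx /= gt_max ltr01; lra.
    by rewrite ltr_distlC maxEle; case: ifPn; rewrite -?ltNge => *;
      apply/andP; split; lra.
  - exists j; have := hge0 t; rewrite ht t0 (ltW t1) => /(_ isT); nra.
rewrite -ltNge => hs.
pose P := [set t | 0 <= t <= 1 /\ h t < 0].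
have Pinf : has_inf P.
  by split; [exists s|exists 0 => t [/andP[]]].
pose t0 := inf P.
have t0_le t : P t -> t0 <= t by exact: (ge_inf Pinf.2).
have t0I : 0 <= t0 <= 1.
  have /andP[_ s1] := sI; apply/andP; split.
    by apply: lb_le_inf => [|t [/andP[]]]; first exact: Pinf.1.
  by apply: le_trans s1; exact: t0_le.
(* Were [h] negative at [t0], then [t0 > 0] because [h 0 = 0], and [h] would be negative slightly to
   the left as well. *)
have ht0 : 0 <= h t0.
  rewrite leNgt; apply/negP => ht0.
  have t00 : 0 < t0.
    rewrite lt_neqAle (andP t0I).1 andbT; apply/eqP => t0E.
    by move: ht0; rewrite -t0E h0 ltxx.
  have [|d d0 dP] := @hcont t0 (- h t0) t0I; first by rewrite oppr_gt0.
  pose t := Num.max 0 (t0 - d / 2).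
  have tlt : t < t0 by rewrite gt_max t00 /=; lra.
  have /andP[_ t01] := t0I.
  have tI : 0 <= t <= 1.
    by rewrite le_max lexx /= (ltW (lt_le_trans tlt t01)).
  have : `|t - t0| < d.
    by rewrite ltr_distlC /t maxEle; case: ifPn; rewrite -?ltNge => *;
      apply/andP; split; lra.
  move=> /(dP _ tI); rewrite ltr_distl => /andP[_ ht].
  have : t0 <= t by apply: t0_le; split=> //; lra.
  by rewrite leNgt tlt.
have [|d d0|j [t [[tI htlt] ht htj]]] := @piece_accumulation P t0 t0I.
- by move=> t [].
- have [t Pt td] := inf_adherent d0 Pinf; exists t => //.
  by rewrite ger0_norm ?subr_ge0 ?t0_le // ltrBlDl.
exists j; have := t0_le _ (conj tI htlt).
have {tI} /andP[t_ge0 t_le1] := tI; have {t0I} /andP[t0_ge0 _] := t0I.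
rewrite le_eqVlt => /orP[/eqP t0t|t0t].
  by move: htlt; rewrite -t0t ltNge ht0.
have bj : b j < 0 by nra.
by split; nra.
Qed.

End PieceCrossing.

(** * Max-min representation of McNaughton functions *)

Section MaxMin.
Variables (R : realType) (n : nat) (xi : 'rV[R]_n -> R).
Hypothesis mxi : mcnaughton_function xi.

Definition affine (p : 'rV[int]_n * int) (x : 'rV[R]_n) : R :=
  \sum_i (p.1 0 i)%:~R * x 0 i + p.2%:~R.

Definition segment (y x : 'rV[R]_n) (t : R) : 'rV[R]_n :=
  \row_i (y 0 i + t * (x 0 i - y 0 i)).

Lemma affine_segment p y x t :
  affine p (segment y x t) = affine p y + t * (affine p x - affine p y).
Proof.
rewrite /affine [in RHS]opprD addrACA subrr addr0 -sumrB mulr_sumr addrAC.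
rewrite -big_split; congr (_ + _); apply: eq_bigr => i _ /=.
by rewrite mxE; ring.
Qed.

Lemma segment0 y x : segment y x 0 = y.
Proof. by apply/rowP => i; rewrite mxE mul0r addr0. Qed.

Lemma segment1 y x : segment y x 1 = x.
Proof. by apply/rowP => i; rewrite mxE mul1r addrC subrK. Qed.

Lemma cube_segment y x t : cube y -> cube x -> 0 <= t <= 1 ->
  cube (segment y x t).
Proof.
move=> cy cx /andP[t0 t1] i; rewrite mxE.
have /andP[? ?] := cy i; have /andP[? ?] := cx i.
by apply/andP; split; nra.
Qed.

Lemma segment_continuous y x t0 e : cube y -> cube x -> 0 <= t0 <= 1 -> 0 < e ->
  exists2 d, 0 < d & forall t, 0 <= t <= 1 -> `|t - t0| < d ->
    `|xi (segment y x t) - xi (segment y x t0)| < e.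
Proof.
move=> cy cx t0I e0; have [_ /subspace_continuousP xic _] := mxi.
have /cvgrPdist_lt/(_ e e0) := xic _ (cube_segment cy cx t0I).
move=> /(@nbhs_ballP R)[d /= d0 dP]; exists d => // t tI td.
rewrite distrC; apply: dP; last exact: cube_segment.
split=> // i j; rewrite !mxE /ball /= /ball_ /=.
have -> : y 0 j + t0 * (x 0 j - y 0 j) - (y 0 j + t * (x 0 j - y 0 j)) =
  (t0 - t) * (x 0 j - y 0 j) by ring.
rewrite normrM distrC; apply: le_lt_trans td; rewrite ler_piMr //.
rewrite ler_norml; have /andP[? ?] := cy j; have /andP[? ?] := cx j.
by apply/andP; split; lra.
Qed.

Variable pieces : seq ('rV[int]_n * int).
Hypothesis xi_pieces : forall x, cube x -> exists2 p, p \in pieces &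
  xi x = affine p x.

Let piece (j : 'I_(size pieces)) := tnth (in_tuple pieces) j.

Lemma xi_piece x : cube x -> exists j, xi x = affine (piece j) x.
Proof.
by move=> /xi_pieces[p /(tnthP (in_tuple pieces))[j ->] ->]; exists j.
Qed.

(** Along the segment from [y] to [x], the difference between [xi] and its chord [q] vanishes at
    both ends, so [piece_crossing] applies to it. *)
Lemma affine_crossing y x : cube y -> cube x ->
  exists j, xi y <= affine (piece j) y /\ affine (piece j) x <= xi x.
Proof.
move=> cy cx; have [xi01 _ _] := mxi.
have /andP[? ?] := xi01 _ cy; have /andP[? ?] := xi01 _ cx.
pose q t := xi y + t * (xi x - xi y).
have [||||j] := @piece_crossing R (size pieces) (fun t => xi (segment y x t) - q t)
  (fun j => affine (piece j) y - xi y)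
  (fun j => affine (piece j) x - affine (piece j) y - (xi x - xi y)).
- move=> t0 e t0I e0; have e20 : 0 < e / 2 by rewrite divr_gt0.
  have [d d0 dP] := segment_continuous cy cx t0I e20.
  exists (Num.min d (e / 2)); first by rewrite lt_min d0.
  move=> t tI; rewrite lt_min => /andP[td te].
  have := dP _ tI td.
  have : `|q t - q t0| < e / 2.
    apply: le_lt_trans te.
    have -> : q t - q t0 = (t - t0) * (xi x - xi y) by rewrite /q; ring.
    rewrite normrM ler_piMr // ler_norml; apply/andP; split; lra.
  rewrite !ltr_norml => /andP[? ?] /andP[? ?]; apply/andP; split; lra.
- move=> t tI; have [j jE] := xi_piece (cube_segment cy cx tI).
  by exists j; rewrite jE affine_segment /q; ring.
- by rewrite /q segment0 mul0r addr0 subrr.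
- by rewrite /q segment1; ring.
- by move=> [? ?]; exists j; split; lra.
Qed.

(* [xi x] is the maximum over [y] of the minimum at [x] of the pieces that
   dominate [xi] at [y]. *)
Lemma mcnaughton_term_fun :
  term_fun (fun w : 'I_n -> unitI R => xi (\row_j sval (w j))).
Proof.
pose above y := [set j | xi y <= affine (piece j) y]%SET.
(* The maximum over the points [y] becomes finite: only the set of dominating pieces matters. *)
pose S := [pred J | `[< exists y, cube y /\ J = above y >]].
have := @term_fun_bigmax R 'I_n {set 'I_(size pieces)} (index_enum _) S
  (fun J w => \big[Num.min/1]_(j in J) clamp (affine (piece j) (\row_i sval (w i)))).
have [xi01 _ _] := mxi.
move=> tf; apply: eq_term_fun (tf _) => [w|J].
  set x := \row_i _.
  have cx : cube x by move=> i; rewrite mxE unitI_ge0 unitI_le1.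
  have /andP[x0 x1] := xi01 _ cx.
  apply/le_anti/andP; split.
    apply: bigmax_le => // _ /asboolP[y [cy ->]].
    have [j [jy jx]] := affine_crossing cy cx.
    apply: (@le_trans _ _ (clamp (affine (piece j) x))).
      by apply: bigmin_le_cond; rewrite inE.
    by rewrite /clamp; minmax_lra.
  (* For the other inequality the point [y = x] suffices: each piece in [above x] is at least [xi x]
     at [x]. *)
  apply: le_trans (le_bigmax_cond _ (j := above x) _ _); last first.
    by apply/asboolP; exists x.
  apply: le_bigmin => // j; rewrite inE => jx.
  by rewrite /clamp; minmax_lra.
apply: term_fun_bigmin => j.
apply: eq_term_fun (clamp_affine R (index_enum _) ((piece j).1 0) id (piece j).2).
by move=> w; congr (clamp (_ + _)); apply: eq_bigr => i _; rewrite mxE.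
Qed.

End MaxMin.

Theorem mcnaughton_map_term (R : realType) (X : Type)
    (eta : (X -> unitI R) -> unitI R) : mcnaughton_map eta ->
  exists t : mvterm X, forall w, eta w = mveval (A := unitI_mv R) w t.
Proof.
move=> [n [i [xi [_ _ mxi etaE]]]]; have [_ _ [pieces pP]] := mxi.
have [t tE] := mcnaughton_term_fun mxi pP.
exists (tsubst (fun j => TVar (i j)) t) => w; apply: unitI_inj.
by rewrite etaE mveval_subst -tE.
Qed.

(** * IMV-algebras and intervals *)

Lemma mvMNr (A : mvAlg) (x y : A) : mvM x (mvN y) = mvB x y.
Proof. by rewrite /mvM mvNK. Qed.

Section IntervalEndpoints.
Variable A : mvAlg.
Implicit Types (x y : mv_interval A) (a b : A).

Lemma itv_eq x y : itv_lo x = itv_lo y -> itv_hi x = itv_hi y -> x = y.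
Proof.
move=> lo hi; apply: mv_interval_inj.
by rewrite (itv_lohi x).2 (itv_lohi y).2 lo hi.
Qed.

Lemma itv_endpoints x a b : mvle a b -> sval x = itv_set a b ->
  itv_lo x = a /\ itv_hi x = b.
Proof.
move=> ab xE; have -> : x = mk_itv ab by exact: mv_interval_inj.
by rewrite itv_loE itv_hiE.
Qed.

Lemma itv_le x : mvle (itv_lo x) (itv_hi x). Proof. exact: (itv_lohi x).1. Qed.

Lemma itv_endpointsN x :
  itv_lo (itv_neg x) = mvN (itv_hi x) /\ itv_hi (itv_neg x) = mvN (itv_lo x).
Proof.
apply: itv_endpoints; first exact/mvleN/itv_le.
by rewrite /= (itv_lohi x).2 mvN_itv.
Qed.

Lemma itv_endpointsD x y :
  itv_lo (itv_oplus x y) = mvD (itv_lo x) (itv_lo y) /\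
  itv_hi (itv_oplus x y) = mvD (itv_hi x) (itv_hi y).
Proof.
apply: itv_endpoints; first by apply: mvleD; exact: itv_le.
by rewrite /= (itv_lohi x).2 (itv_lohi y).2 mvD_itv //; exact: itv_le.
Qed.

Lemma itv_endpointsM x y :
  itv_lo (itv_odot x y) = mvM (itv_lo x) (itv_lo y) /\
  itv_hi (itv_odot x y) = mvM (itv_hi x) (itv_hi y).
Proof.
apply: itv_endpoints; first by apply: mvleM; exact: itv_le.
by rewrite /= (itv_lohi x).2 (itv_lohi y).2 mvM_itv //; exact: itv_le.
Qed.

Lemma itv_endpoints_iota :
  itv_lo (itv_iota A) = mv0 /\ itv_hi (itv_iota A) = mv1.
Proof.
apply: itv_endpoints; first exact: mv0le.
by apply/seteqP; split=> // t _; split; [exact: mv0le|exact: mvle1].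
Qed.

Lemma itv_lo_point a : itv_lo (itv_point a) = a. Proof. exact: itv_loE. Qed.
Lemma itv_hi_point a : itv_hi (itv_point a) = a. Proof. exact: itv_hiE. Qed.

Definition itvE := (fun x => (itv_endpointsN x).1, fun x => (itv_endpointsN x).2,
  fun x y => (itv_endpointsD x y).1, fun x y => (itv_endpointsD x y).2,
  fun x y => (itv_endpointsM x y).1, fun x y => (itv_endpointsM x y).2,
  itv_endpoints_iota.1, itv_endpoints_iota.2, itv_lo_point, itv_hi_point).

Lemma intervalAlg_IMV : is_IMV (intervalAlg A).
Proof.
have M1 a : mvM mv1 a = a by rewrite /mvM mvN1 mv0D mvNK.
have M0 a : mvM mv0 a = mv0 by rewrite /mvM mv1D mvN1.
split=> /= *; rewrite /itv_Delta /itv_Nabla; apply: itv_eq;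
  rewrite !itvE ?mvDA ?mvD0 ?mvDN0 ?mvNK ?mvN1 //.
- exact: mvDC.
- exact: mvDC.
- exact: mv_luk.
- exact: mv_luk.
- by rewrite mvMNr; apply/mvB_eq0; exact: itv_le.
- by rewrite mvMNr; apply/mvB_eq0; exact: itv_le.
- by rewrite !M0 mvD0.
- by rewrite M1 mvMNr mvBK //; exact: itv_le.
Qed.

End IntervalEndpoints.

Section IMVTheory.
Variables (J : imvSig) (IJ : is_IMV J).
Implicit Types x y : J.
Local Open Scope imv_scope.

Lemma imvN_inj : injective (@imvN J).
Proof. by move=> x y xy; rewrite -(imvNK IJ x) xy imvNK. Qed.

Lemma imvND x y : ¬ (x ⊕ y) = ¬ x ⊙ ¬ y.
Proof. by rewrite (imvME IJ) !(imvNK IJ). Qed.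

Lemma imvNM x y : ¬ (x ⊙ y) = ¬ x ⊕ ¬ y.
Proof. by rewrite (imvME IJ) (imvNK IJ). Qed.

Lemma NablaN x : ∇ ¬ x = ¬ Δ x.
Proof. by rewrite (NablaE IJ) (imvNK IJ). Qed.

Lemma DeltaN x : Δ ¬ x = ¬ ∇ x.
Proof. by rewrite (NablaE IJ) (imvNK IJ). Qed.

Lemma NablaD x y : ∇ (x ⊕ y) = ∇ x ⊕ ∇ y.
Proof. by rewrite !(NablaE IJ) imvND (DeltaM IJ) imvNM. Qed.

Lemma NablaM x y : ∇ (x ⊙ y) = ∇ x ⊙ ∇ y.
Proof. by rewrite !(NablaE IJ) imvNM (DeltaD IJ) imvND. Qed.

Lemma Nabla_Delta x : ∇ Δ x = Δ x.
Proof. by rewrite (NablaE IJ) -(NablaN x) (Delta_Nabla IJ) NablaN (imvNK IJ). Qed.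

Lemma Nabla_iota : ∇ ι = 1 :> J.
Proof. by rewrite (NablaE IJ) (imvN_iota IJ) (Delta_iota IJ) -(imv1E IJ). Qed.

Lemma imv_ext x y : Δ x = Δ y -> ∇ x = ∇ y -> x = y.
Proof.
by move=> D N; rewrite -(imv_decomp IJ x) -(imv_decomp IJ y) D N.
Qed.

Definition sharp := {x : J | Δ x = x}.

Fact sharp_neg x : Δ x = x -> Δ ¬ x = ¬ x.
Proof. by move=> xE; rewrite DeltaN -{1}xE Nabla_Delta xE. Qed.

Fact sharp_add x y : Δ x = x -> Δ y = y -> Δ (x ⊕ y) = x ⊕ y.
Proof. by move=> xE yE; rewrite (DeltaD IJ) xE yE. Qed.

Definition mk_sharp x (xE : Δ x = x) : sharp := exist (fun x => Δ x = x) x xE.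

Definition sharp0 := mk_sharp (Delta0 IJ).
Definition sharpN (x : sharp) := mk_sharp (sharp_neg (svalP x)).
Definition sharpD (x y : sharp) := mk_sharp (sharp_add (svalP x) (svalP y)).

Lemma sharp_inj (x y : sharp) : sval x = sval y -> x = y.
Proof. by case: x y => [x p] [y q] /= xy; exact/eq_exist. Qed.

Fact sharpDA (x y z : sharp) : sharpD x (sharpD y z) = sharpD (sharpD x y) z.
Proof. by apply: sharp_inj; exact: (imvDA IJ). Qed.
Fact sharpDC (x y : sharp) : sharpD x y = sharpD y x.
Proof. by apply: sharp_inj; exact: (imvDC IJ). Qed.
Fact sharpD0 (x : sharp) : sharpD x sharp0 = x.
Proof. by apply: sharp_inj; exact: (imvD0 IJ). Qed.
Fact sharpNK (x : sharp) : sharpN (sharpN x) = x.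
Proof. by apply: sharp_inj; exact: (imvNK IJ). Qed.
Fact sharpDN0 (x : sharp) : sharpD x (sharpN sharp0) = sharpN sharp0.
Proof. by apply: sharp_inj; exact: (imvDN0 IJ). Qed.
Fact sharp_luk (x y : sharp) :
  sharpD (sharpN (sharpD (sharpN x) y)) y = sharpD (sharpN (sharpD (sharpN y) x)) x.
Proof.
apply: sharp_inj; have := imv_luk IJ (sval x) (sval y).
by rewrite (svalP x) (svalP y).
Qed.

Definition sharp_mv : mvAlg :=
  MvAlg sharpDA sharpDC sharpD0 sharpNK sharpDN0 sharp_luk.

Definition sharp_lo x : sharp_mv := mk_sharp (DeltaK IJ x).
Definition sharp_hi x : sharp_mv := mk_sharp (Delta_Nabla IJ x).

Lemma sharp_lo_hi x : mvle (sharp_lo x) (sharp_hi x).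
Proof.
apply: sharp_inj => /=; apply: imvN_inj; rewrite (imvNK IJ).
by rewrite -(Delta_le_Nabla IJ x) (imvME IJ) (imvNK IJ).
Qed.

Lemma Nabla_sharp (a : sharp_mv) : ∇ sval a = sval a.
Proof. by rewrite -(svalP a) Nabla_Delta. Qed.

(** The expression of [imv_decomp] with arbitrary endpoints: it rebuilds an element from its [Δ] and
    [∇]. *)
Definition imv_pair (a b : sharp_mv) : J := sval a ⊕ (ι ⊙ sval b ⊙ ¬ sval a).

Lemma Delta_pair a b : Δ imv_pair a b = sval a.
Proof.
have M0 x : 0 ⊙ x = 0 :> J.
  by rewrite (imvME IJ) (imvDC IJ) (imvDN0 IJ) (imvNK IJ).
rewrite /imv_pair (DeltaD IJ) !(DeltaM IJ) (Delta_iota IJ) !M0 (imvD0 IJ).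
exact: (svalP a).
Qed.

Lemma Nabla_pair a b : mvle a b -> ∇ imv_pair a b = sval b.
Proof.
have M1 x : 1 ⊙ x = x :> J.
  by rewrite (imvME IJ) (imv1E IJ) !(imvNK IJ) (imvDC IJ) (imvD0 IJ) (imvNK IJ).
move=> ab; rewrite /imv_pair NablaD !NablaM Nabla_iota M1 NablaN.
rewrite !Nabla_sharp (svalP a) (imvME IJ) (imvNK IJ).
exact: (congr1 sval (mvBK ab)).
Qed.

Lemma intervalAlg_hom (A : mvAlg) (phi : A -> sharp_mv) : mv_hom phi ->
  imv_hom (fun x : intervalAlg A => imv_pair (phi (itv_lo x)) (phi (itv_hi x))).
Proof.
move=> [phi0 phiN phiD].
have phi_le a b : mvle a b -> mvle (phi a) (phi b).
  by move=> ab; rewrite /mvle -phiN -phiD (ab : _ = mv1) /mv1 phiN phi0.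
have phiM a b : phi (mvM a b) = mvM (phi a) (phi b).
  by rewrite /mvM !(phiN, phiD).
have sM (a b : sharp_mv) : sval (mvM a b) = sval a ⊙ sval b.
  by rewrite (imvME IJ).
have phi1 : sval (phi mv1) = 1 by rewrite phiN phi0 (imv1E IJ).
set h := (X in imv_hom X).
have lo (x : intervalAlg A) : Δ h x = sval (phi (itv_lo x)).
  exact: Delta_pair.
have hi (x : intervalAlg A) : ∇ h x = sval (phi (itv_hi x)).
  by apply/Nabla_pair/phi_le/itv_le.
(* From here on [h] is known only through its endpoints [lo] and [hi]; by [imv_ext] each law is
   checked on these. *)
clearbody h.
have N0 : ∇ 0 = 0 :> J by rewrite -(Delta0 IJ) Nabla_Delta.
have N1 : ∇ 1 = 1 :> J by rewrite -(Delta1 IJ) Nabla_Delta.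
by split=> /= *; apply: imv_ext; rewrite ?NablaN ?DeltaN
  ?(DeltaD IJ) ?(DeltaM IJ) ?NablaD ?NablaM ?(DeltaK IJ) ?(Delta_Nabla IJ)
  ?Nabla_Delta ?lo ?hi ?Nabla_sharp /itv_Delta /itv_Nabla !itvE
  ?(phiM, phiN, phiD, phi0, phi1) ?sM ?(Delta0 IJ, Delta1 IJ, Delta_iota IJ)
  ?(N0, N1, Nabla_iota) ?(svalP (phi _)).
Qed.

End IMVTheory.

(** * The free IMV-algebra *)

Section FreeMcN.
Variables (R : realType) (K : Type) (K0 : inhabited K).

Definition gens (x : K * bool) : McN_Theta R K0 :=
  if x.2 then gen_hi R K0 x.1 else gen_lo R K0 x.1.

Lemma mveval_gens (t : mvterm (K * bool)) (s : Theta_pow R K) :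
  sval (mveval gens t) s = mveval (A := unitI_mv R) (sval s) t.
Proof. by elim: t => [[k []]||t /= ->|t1 /= -> t2 /= ->]. Qed.

Lemma McN_Theta_term (f : McN_Theta R K0) : exists t, mveval gens t = f.
Proof.
have [eta /mcnaughton_map_term[t tE] fE] := svalP f.
by exists t; apply: McN_inj => s; rewrite mveval_gens fE tE.
Qed.

(* Replacing [x (k, false)] by its meet with [x (k, true)] maps the whole cube
   into [Theta_pow] and does not change the value at points of an MV-algebra
   that satisfy [v (k, false) <= v (k, true)]. *)
Lemma mveval_gens_inj (s t : mvterm (K * bool)) (B : mvAlg)
    (v : K * bool -> B) : (forall k, mvle (v (k, false)) (v (k, true))) ->
  mveval gens s = mveval gens t -> mveval v s = mveval v t.
Proof.
move=> vle st; have [k0] := K0.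
pose sg (x : K * bool) := if x.2 then TVar (x.1, true)
  else tmin (TVar (x.1, false)) (TVar (x.1, true)).
have vE r : mveval v r = mveval v (tsubst sg r).
  rewrite mveval_subst; apply: eq_mveval => -[k []] _ //=.
  exact/esym/mvmin_l/vle.
rewrite (vE s) (vE t); apply: (chang_completeness (R := R) (k0, true)) => w.
rewrite !mveval_subst; set w' := fun x => mveval _ (sg x).
have w'T : Theta_pow R K w'.
  move=> k; apply/unitI_mvleE.
  exact: (@mvmin_ler (unitI_mv R) (w (k, false)) (w (k, true))).
have := congr1 (fun f : McN_Theta R K0 => sval f (SigSub (mem_set w'T))) st.
by rewrite !mveval_gens.
Qed.

(** [phi] evaluates at [v] a chosen term representing the function. By [mveval_gens_inj] the value
    does not depend on the choice, which gives the homomorphism laws. *)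
Lemma McN_Theta_ump (B : mvAlg) (v : K * bool -> B) :
  (forall k, mvle (v (k, false)) (v (k, true))) ->
  exists2 phi : McN_Theta R K0 -> B, mv_hom phi &
    forall x, phi (gens x) = v x.
Proof.
move=> vle; have [tm tmE] := choice McN_Theta_term.
have inj := mveval_gens_inj vle.
exists (fun f => mveval v (tm f)); last first.
  by move=> x; rewrite -[RHS]/(mveval v (TVar x)); apply: inj; rewrite tmE.
split=> [|f|f g].
- by rewrite -[RHS]/(mveval v TZero); apply: inj; rewrite tmE.
- by rewrite -[RHS]/(mveval v (TNeg (tm f))); apply: inj; rewrite /= !tmE.
- rewrite -[RHS]/(mveval v (TAdd (tm f) (tm g))).
  by apply: inj; rewrite /= !tmE.
Qed.

(** [Δ] and [∇] of the generators are the point intervals at the coordinates; terms in these give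
    all point intervals, and [imv_decomp] gives the rest. *)
Lemma generator_generates : imv_generates (range (generator R K0)).
Proof.
move=> P subP gP; apply/seteqP; split=> // x _.
have point (a : McN_Theta R K0) : P (itv_point a).
  have [t <-] := McN_Theta_term a; elim: t => [[k b]||t IH|t1 IH1 t2 IH2].
  - have Pk : P (generator R K0 k) by apply: gP; exists k.
    rewrite /= /gens; case: b => /=.
      by have := subNabla subP Pk; rewrite /= /itv_Nabla itv_hiE.
    by have := subDelta subP Pk; rewrite /= /itv_Delta itv_loE.
  - exact: (sub0 subP).
  - suff -> : itv_point (mveval gens (TNeg t)) = itv_neg (itv_point (mveval gens t)).
      exact: (subN subP IH).
    by apply: itv_eq; rewrite !itvE.
  - suff -> : itv_point (mveval gens (TAdd t1 t2)) =
        itv_oplus (itv_point (mveval gens t1)) (itv_point (mveval gens t2)).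
      exact: (subD subP IH1 IH2).
    by apply: itv_eq; rewrite !itvE.
rewrite -(imv_decomp (intervalAlg_IMV _) x).
apply: (subD subP); first exact: point.
apply: (subM subP); last by apply: (subN subP); exact: point.
by apply: (subM subP); [exact: (sub_iota subP)|exact: point].
Qed.

Lemma generator_inj : injective (generator R K0).
Proof.
move=> k k' /(congr1 (@itv_lo _)); rewrite !itv_loE => kk'.
(* The point with pair (0, 0) at [k] and (1, 1) elsewhere separates the lower endpoints. *)
pose w (x : K * bool) : unitI R := if `[< x.1 = k >] then u0 R else uN (u0 R).
have wT : Theta_pow R K w by move=> j; rewrite /Theta /= /w /= lexx.
have := congr1 (fun f : McN_Theta R K0 => sval (sval f (SigSub (mem_set wT)))) kk'.
rewrite /= /w /= (asboolT (erefl k)); case: asboolP => [->//|_ /= /eqP].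
by rewrite subr0 eq_sym oner_eq0.
Qed.

End FreeMcN.

(** The equalizer of two homomorphisms is a subuniverse. *)
Lemma imv_hom_eq (K : Type) (J J' : imvSig) (g : K -> J) (h h' : J -> J') :
  imv_generates (range g) -> imv_hom h -> imv_hom h' ->
  (forall k, h (g k) = h' (g k)) -> h = h'.
Proof.
move=> gen hh hh' hg; apply/funext => x.
suff : [set x | h x = h' x] x by [].
rewrite (gen [set x | h x = h' x]) //; last by move=> _ [k _ <-]; exact: hg.
case: hh => ? ? ? hN hD hNa hp hm; case: hh' => ? ? ? hN' hD' hNa' hp' hm'.
split=> /=; [congruence|congruence|congruence|..].
- by move=> y; rewrite hN hN' => ->.
- by move=> y; rewrite hD hD' => ->.
- by move=> y; rewrite hNa hNa' => ->.
- by move=> y z; rewrite hp hp' => -> ->.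
- by move=> y z; rewrite hm hm' => -> ->.
Qed.

Lemma imv_hom_comp (J J' J'' : imvSig) (h : J -> J') (h' : J' -> J'') :
  imv_hom h -> imv_hom h' -> imv_hom (h' \o h).
Proof.
case=> h0 h1 hi hN hD hNa hp hm; case=> h0' h1' hi' hN' hD' hNa' hp' hm'.
by split=> /= *; rewrite ?(h0, h1, hi, hN, hD, hNa, hp, hm).
Qed.

Lemma imv_hom_id (J : imvSig) : imv_hom (@id J). Proof. by []. Qed.

Lemma generator_free (R : realType) (K : Type) (K0 : inhabited K) :
  is_free_IMV (generator R K0).
Proof.
split; [exact: intervalAlg_IMV|exact: generator_inj|exact: generator_generates|].
move=> J IJ f.
pose v (x : K * bool) : sharp_mv IJ :=
  if x.2 then sharp_hi IJ (f x.1) else sharp_lo IJ (f x.1).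
have [k|phi hphi phiE] := @McN_Theta_ump R K K0 _ v; first exact: sharp_lo_hi.
exists (fun x => imv_pair (phi (itv_lo x)) (phi (itv_hi x))).
have hhom := intervalAlg_hom hphi.
have hgen k : imv_pair (phi (itv_lo (generator R K0 k)))
    (phi (itv_hi (generator R K0 k))) = f k.
  rewrite itv_loE itv_hiE (phiE (k, false)) (phiE (k, true)).
  exact: (imv_decomp IJ).
split=> // h' [h'hom h'gen].
apply: (imv_hom_eq (@generator_generates R K K0)) => // k.
by rewrite hgen h'gen.
Qed.

(** The nonempty type [K] plays the role of the cardinal. The universal properties yield
    homomorphisms both ways; their composites fix the generators, hence are identities. *)
Theorem theorem5p2 (R : realType) (K : Type) (K0 : inhabited K) :
  is_free_IMV (generator R K0) /\
  (forall (F : imvSig) (g : K -> F), is_free_IMV g ->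
    exists h : F -> intervalAlg (McN_Theta R K0),
      imv_iso h /\ (forall k, h (g k) = generator R K0 k)).
Proof.
have free := generator_free R K0; split=> // F g freeg.
have [h [[hhom hg] _]] := free_ump freeg (free_IMV free) (generator R K0).
have [h' [[h'hom h'g] _]] := free_ump free (free_IMV freeg) g.
exists h; split=> //; split=> //; exists h'.
- have E : h' \o h = id.
    apply: (imv_hom_eq (free_gen freeg)); [exact: imv_hom_comp|exact: imv_hom_id|].
    by move=> k /=; rewrite hg h'g.
  by move=> x; rewrite -[LHS]/((h' \o h) x) E.
- have E : h \o h' = id.
    apply: (imv_hom_eq (free_gen free)); [exact: imv_hom_comp|exact: imv_hom_id|].
    by move=> k /=; rewrite h'g hg.
  by move=> x; rewrite -[LHS]/((h \o h') x) E.
Qed.
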